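(* For a curve $\{K_t\}_{t\in I}$ of $\mathbf{D}$-complex structures on a compact manifold $X$, with $I\subseteq\mathbb{R}$ an interval, the functions $$I\ni t\mapsto \dim_{\mathbb{R}}H^{2\,+}_{K_t}(X;\mathbb{R})\in\mathbb{N}\qquad\text{and}\qquad I\ni t\mapsto \dim_{\mathbb{R}}H^{2\,-}_{K_t}(X;\mathbb{R})\in\mathbb{N}$$ are in general neither upper-semi-continuous nor lower-semi-continuous. That is, for each sign $\pm\in\{+,-\}$ there exist a compact manifold $X$ and a smooth curve $\{K_t\}_{t\in I}$ of $\mathbf{D}$-complex structures on $X$ such that $t\mapsto\dim_{\mathbb{R}}H^{2\,\pm}_{K_t}(X;\mathbb{R})$ is not upper-semi-continuous, and there exist a compact manifold $X$ and a smooth curve $\{K_t\}_{t\in I}$ of $\mathbf{D}$-complex structures on $X$ such that $t\mapsto\dim_{\mathbb{R}}H^{2\,\pm}_{K_t}(X;\mathbb{R})$ is not lower-semi-continuous.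
   Context: An almost $\mathbf{D}$-complex structure on a $2n$-dimensional manifold $X$ is $K\in\mathrm{End}(TX)$ with $K^2=\mathrm{id}_{TX}$ whose eigenbundles $T^+X$, $T^-X$ for the eigenvalues $+1,-1$ both have rank $n$. It is integrable (then called $\mathbf{D}$-complex) if $[T^+X,T^+X]\subseteq T^+X$ and $[T^-X,T^-X]\subseteq T^-X$. $K$ acts on $2$-forms by $(K\alpha)(\cdot,\cdot)=\alpha(K\cdot,K\cdot)$, and $H^{2\,\pm}_K(X;\mathbb{R})=\{[\alpha]\in H^2_{dR}(X;\mathbb{R}) : \alpha \text{ a closed } 2\text{-form with } K\alpha=\pm\alpha\}$. *)

(* Defs.v *)
From HB Require Import structures.
From mathcomp Require Import all_boot all_order all_algebra.
From mathcomp Require Import all_classical all_reals all_analysis.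

Set Implicit Arguments.
Unset Strict Implicit.
Unset Printing Implicit Defensive.

Import Order.TTheory GRing.Theory Num.Theory.
Import numFieldNormedType.Exports.

Local Open Scope classical_set_scope.
Local Open Scope ring_scope.

Section Smoothness.
Context {R : realType} {V W : normedModType R}.

(* Used only for finite-dimensional V and open U, where existence and
   continuity of all iterated directional derivatives of order at most k is
   the usual C^k condition. *)
Fixpoint Ck (k : nat) (U : set V) (f : V -> W) : Prop :=
  (forall x, U x -> {for x, continuous f}) /\
  (if k is k'.+1 then
     forall v : V, (forall x, U x -> derivable f x v) /\ Ck k' U ('D_v f)
   else True).

(* A need not be open: f is smooth on A when it extends, near each point of A,
   to a C^oo function on an open set. For A open this is C^oo on A; the general
   case is needed for I x U with I an interval that may contain endpoints. *)
Definition smooth_on (A : set V) (f : V -> W) : Prop :=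
  forall x, A x -> exists (U : set V) (g : V -> W),
    [/\ open U, U x, (forall k, Ck k U g) &
        forall y, U y -> A y -> f y = g y].

End Smoothness.

(* Smooth m-manifolds without boundary, given by a smooth atlas. The chart
   [mphi c] is a homeomorphism from [mdom c] onto the open set
   [mphi c @` mdom c], with inverse [mpsi c]; the values of [mphi c] and
   [mpsi c] elsewhere are irrelevant. *)
Record manifold (R : realType) (m : nat) := Manifold {
  mspace :> topologicalType;
  mchart : Type;
  mdom : mchart -> set mspace;
  mphi : mchart -> mspace -> 'rV[R]_m;
  mpsi : mchart -> 'rV[R]_m -> mspace;
  manifold_hausdorff : hausdorff_space mspace;
  manifold_second_countable : @second_countable mspace;
  mdom_open : forall c, open (mdom c);
  mdom_cover : forall p, exists c, mdom c p;
  mcod_open : forall c, open (mphi c @` mdom c);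
  mphiK : forall c p, mdom c p -> mpsi c (mphi c p) = p;
  mphi_continuous : forall c, {within mdom c, continuous (mphi c)};
  mpsi_continuous : forall c, {within mphi c @` mdom c, continuous (mpsi c)};
  mtrans_smooth : forall c c',
    smooth_on [set x | (mphi c @` mdom c) x /\ mdom c' (mpsi c x)]
              (mphi c' \o mpsi c)
}.

Section Tensors.
Context {R : realType} {m : nat} (X : manifold R m).

Definition mcod (c : mchart X) : set 'rV[R]_m := mphi c @` mdom c.

Definition moverlap (c c' : mchart X) : set 'rV[R]_m :=
  [set x | mcod c x /\ mdom c' (mpsi c x)].

Definition mtrans (c c' : mchart X) : 'rV[R]_m -> 'rV[R]_m :=
  mphi c' \o mpsi c.

(* Tensor fields are given by their components in each chart, as functions of
   the coordinates, subject to the transformation law. Tangent vectors are row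
   vectors, so that [v *m jacobian f x] is the differential of f applied to v.
   Components at points outside [mcod c] are irrelevant. *)
Definition rvfield : Type := mchart X -> 'rV[R]_m -> 'rV[R]_m.
Definition mxfield : Type := mchart X -> 'rV[R]_m -> 'M[R]_m.

Definition vector_field (v : rvfield) : Prop :=
  (forall c, smooth_on (mcod c) (v c)) /\
  (forall c c' x, moverlap c c' x ->
     v c' (mtrans c c' x) = v c x *m jacobian (mtrans c c') x).

Definition lie_bracket (v w : rvfield) : rvfield :=
  fun c x => 'D_(v c x) (w c) x - 'D_(w c x) (v c) x.

(* b pairs with a tangent vector v as [v *m (b c x)^T]. *)
Definition one_form (b : rvfield) : Prop :=
  (forall c, smooth_on (mcod c) (b c)) /\
  (forall c c' x, moverlap c c' x ->
     b c x = b c' (mtrans c c' x) *m (jacobian (mtrans c c') x)^T).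

(* a evaluates on tangent vectors v, w as [v *m a c x *m w^T]. *)
Definition two_form (a : mxfield) : Prop :=
  [/\ forall c, smooth_on (mcod c) (a c),
      forall c x, mcod c x -> (a c x)^T = - a c x &
      forall c c' x, moverlap c c' x ->
        a c x = jacobian (mtrans c c') x *m a c' (mtrans c c' x)
                  *m (jacobian (mtrans c c') x)^T].

Definition partial (i : 'I_m) (f : 'rV[R]_m -> R) : 'rV[R]_m -> R :=
  'D_(delta_mx 0 i) f.

Definition d_one_form (b : rvfield) : mxfield := fun c x =>
  \matrix_(i, j) (partial i (fun y => b c y 0 j) x
                  - partial j (fun y => b c y 0 i) x).

Definition closed_two_form (a : mxfield) : Prop :=
  two_form a /\
  forall c x, mcod c x -> forall i j k,
    partial i (fun y => a c y j k) x + partial j (fun y => a c y k i) x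
      + partial k (fun y => a c y i j) x = 0.

Definition exact_two_form (a : mxfield) : Prop :=
  exists2 b, one_form b & forall c x, mcod c x -> a c x = d_one_form b c x.

Definition deRham_class (a : mxfield) : set mxfield :=
  [set a' | closed_two_form a' /\ exact_two_form (a' - a)].

(* [e] represents a basis of the linear subspace H of the second de Rham
   cohomology, whose operations are those of representatives. *)
Definition deRham_basis (H : set (set mxfield)) (k : nat) (e : 'I_k -> mxfield) :
    Prop :=
  (forall i, H (deRham_class (e i))) /\
  (forall h, H h ->
     exists! a : 'rV[R]_k, h = deRham_class (\sum_(i < k) a 0 i *: e i)).

Definition deRham_dim (H : set (set mxfield)) (k : nat) : Prop :=
  exists e : 'I_k -> mxfield, deRham_basis H e.

(* A field K of endomorphisms sends the tangent vector v to [v *m K c x]. *)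
Definition endo_field (K : mxfield) : Prop :=
  (forall c, smooth_on (mcod c) (K c)) /\
  (forall c c' x, moverlap c c' x ->
     K c x *m jacobian (mtrans c c') x =
     jacobian (mtrans c c') x *m K c' (mtrans c c' x)).

Definition eigen_section (K : mxfield) (l : R) (v : rvfield) : Prop :=
  vector_field v /\ forall c x, mcod c x -> v c x *m K c x = l *: v c x.

Definition involutive_eigenbundle (K : mxfield) (l : R) : Prop :=
  forall v w, eigen_section K l v -> eigen_section K l w ->
    eigen_section K l (lie_bracket v w).

(* (K a)(v, w) = a(K v, K w) *)
Definition endo_act (K a : mxfield) : mxfield :=
  fun c x => K c x *m a c x *m (K c x)^T.

(* s = false is the sign +, s = true is the sign -. *)
Definition H2pm (K : mxfield) (s : bool) : set (set mxfield) :=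
  [set deRham_class a | a in [set a | closed_two_form a /\
     forall c x, mcod c x -> endo_act K a c x = (-1) ^+ s *: a c x]].

End Tensors.

Section DComplex.
Context {R : realType} {n : nat} {X : manifold R n.*2}.

Definition almost_D_complex (K : mxfield X) : Prop :=
  endo_field K /\
  forall c x, mcod c x ->
    [/\ K c x *m K c x = 1%:M,
        \rank (eigenspace (K c x) 1) = n &
        \rank (eigenspace (K c x) (-1)) = n].

Definition D_complex (K : mxfield X) : Prop :=
  [/\ almost_D_complex K, involutive_eigenbundle K 1 &
      involutive_eigenbundle K (-1)].

(* Smooth curve: the components are smooth jointly in t and the coordinates. *)
Definition D_complex_curve (I : set R) (K : R -> mxfield X) : Prop :=
  (forall t, I t -> D_complex (K t)) /\
  (forall c, smooth_on [set z : R * 'rV[R]_n.*2 | I z.1 /\ mcod c z.2]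
                       (fun z => K z.1 c z.2)).

End DComplex.

(* Semi-continuity of the restriction of f to I. *)
Definition lower_semicontinuous_on {R : realType} (I : set R) (f : R -> \bar R) :
    Prop :=
  lower_semicontinuous (f : subspace I -> \bar R).

Definition upper_semicontinuous_on {R : realType} (I : set R) (f : R -> \bar R) :
    Prop :=
  lower_semicontinuous_on I (fun t => - f t)%E.

(* Main.v *)
Require Import Defs.
From HB Require Import structures.
From mathcomp Require Import all_boot all_order all_algebra.
From mathcomp Require Import all_classical all_reals all_analysis.
From mathcomp Require Import ring lra zify.

Set Implicit Arguments.
Unset Strict Implicit.
Unset Printing Implicit Defensive.

Import Order.TTheory GRing.Theory Num.Theory.
Import numFieldNormedType.Exports.

Local Open Scope classical_set_scope.
Local Open Scope ring_scope.

(** On [T^4 = R^4 / Z^4] with coordinates [x0, x1, x2, x3] and for a periodic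
    function [g] of [x0], let [K_g] be [1] on [<d_0, d_2>] and [-1] on
    [<d_1 + g d_0, d_3>]; both distributions are involutive. Put [j = 2] for the
    sign [+] and [j = 3] for the sign [-]. A form [a] is of type [+] iff
    [a_01 = a_03 = a_23 = 0] and [a_1j = - g a_0j], and of type [-] iff
    [a_02 = 0] and [a_1j = - g a_0j].

    A closed form on the torus is cohomologous to the constant form of its mean
    coefficients, so the classes of forms of a given type are determined by
    these means. If [a] is closed, the average of [a_1j] over [x1, x2, x3] does
    not depend on [x0]; it equals [- g(x0)] times the average of [a_0j]. Take
    [g = a + b sin^2 (pi x0)] with [a, b >= 0].
    - If [a = 0 < b], the zero of [g] forces the means of [a_1j] and [a_0j] to
      vanish.
    - If [a > 0], these means lie on a line, and [(dx0 / g - dx1) /\ dxj] is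
      closed.
    - If [a = b = 0], the mean of [a_1j] vanishes, and [dx0 /\ dxj] is closed.
    So the dimension drops by one exactly when [a = 0 < b]: the curve
    [(a, b) = (t, 1)] breaks upper and [(0, t)] breaks lower semi-continuity at
    [t = 0]. *)

(** * Smooth functions *)

Section SmoothFunctions.
Context {R : realType}.
Implicit Types V W : normedModType R.

(** Smoothness on the whole space is enough here: fields on the torus are studied through their
    lifts to [R^m]. *)
Definition smooth V W (f : V -> W) : Prop := forall k, Ck k setT f.

Lemma Ck_continuous V W k U (f : V -> W) x :
  Ck k U f -> U x -> {for x, continuous f}.
Proof. by case: k => [|k] [cf _]; exact: cf. Qed.

Lemma CkW V W k U (f : V -> W) : Ck k.+1 U f -> Ck k U f.
Proof.
elim: k f => [|k IHk] f [cf df]; first by split.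
by split=> // v; have [dfv Dfv] := df v; split=> //; exact: IHk.
Qed.

Lemma smooth_continuous V W (f : V -> W) : smooth f -> continuous f.
Proof. by move=> sf x; apply: (Ck_continuous (sf 0)). Qed.

Lemma smooth_derivable V W (f : V -> W) x v : smooth f -> derivable f x v.
Proof. by move=> /(_ 1)[_ /(_ v)[df _]]; apply: df. Qed.

Lemma smooth_derive V W (f : V -> W) v : smooth f -> smooth ('D_v f).
Proof. by move=> sf k; have [_ /(_ v)[_]] := sf k.+1. Qed.

(** Coinductive criterion: smoothness follows from exhibiting a class of functions stable under
    directional derivatives. It serves for constants, matrix entries, sine and averages. *)
Lemma smooth_ind V W (P : (V -> W) -> Prop) :
  (forall f, P f -> [/\ continuous f, (forall x v, derivable f x v) &
     forall v, P ('D_v f)]) ->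
  forall f, P f -> smooth f.
Proof.
move=> HP f Pf k; elim: k f Pf => [|k IHk] f /HP[cf df Df].
  by split=> // x _; exact: cf.
by split=> [x _|v]; [exact: cf|split=> [x _|]; [exact: df|exact/IHk/Df]].
Qed.

Lemma near_eq_Ck V W k (U : set V) (f g : V -> W) :
  (forall x, U x -> \forall y \near x, f y = g y) -> Ck k U f -> Ck k U g.
Proof.
elim: k U f g => [|k IHk] U f g fg [cf df]; (split; [|try exact: I]).
1,2: move=> x Ux; have := cf x Ux; rewrite /prop_for /continuous_at;
  rewrite (nbhs_singleton (fg x Ux)); apply: cvg_trans; apply: near_eq_cvg;
  exact: filterS (fg x Ux) => y ->.
move=> v; have [dfv Dfv] := df v; split=> [x Ux|].
  by apply: near_eq_derivable (dfv x Ux); exact: fg.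
apply: IHk Dfv => x Ux.
have /near_join := fg x Ux.
by apply: filterS => y; exact: near_eq_derive.
Qed.

Lemma Ck_cover V W k (f : V -> W) :
  (forall x : V, exists2 U : set V, open U /\ U x & Ck k U f) -> Ck k setT f.
Proof.
elim: k f => [|k IHk] f covf; (split; [|try exact: I]).
1,2: by move=> x _; have [U [_ Ux] [cf _]] := covf x; exact: cf.
move=> v; split=> [x _|].
  by have [U [_ Ux] [_ /(_ v)[df _]]] := covf x; exact: df.
by apply: IHk => x; have [U oU [_ /(_ v)[_]]] := covf x; exists U.
Qed.

Lemma smooth_smooth_on V W (A : set V) (f : V -> W) : smooth f -> smooth_on A f.
Proof. by move=> sf x Ax; exists setT, f; split=> //; exact: openT. Qed.


Lemma CkS V W k (A B : set V) (f : V -> W) : A `<=` B -> Ck k B f -> Ck k A f.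
Proof.
move=> AB; elim: k f => [|k IHk] f [cf df]; (split; [|try exact: I]).
1,2: by move=> x /AB; exact: cf.
move=> v; have [dfv Dfv] := df v; split=> [x /AB|]; first exact: dfv.
exact: IHk.
Qed.

(** Near [x] the extension given by [smooth_on] coincides with [f], because [A] contains a
    neighbourhood of [x]; the local pieces are glued by [Ck_cover]. *)
Lemma smooth_of_local V W (f : V -> W) :
  (forall x : V, exists2 A : set V, nbhs x A &
     exists2 h : V -> W, smooth_on A h &
     forall y, A y -> f y = h y) -> smooth f.
Proof.
move=> locf k; apply: Ck_cover => x.
have [A Ax [h sh fh]] := locf x.
have [U [g [oU Ux Cg hg]]] := sh x (nbhs_singleton Ax).
have oI : open (A^° `&` U) by apply: openI => //; exact: open_interior.
exists (A^° `&` U); first by [].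
apply: near_eq_Ck (CkS (@subIsetr _ _ _) (Cg k)) => y AUy.
apply: filterS (open_nbhs_nbhs (conj oI AUy)) => z [Az Uz].
have {}Az := interior_subset Az.
by rewrite fh// hg.
Qed.

Lemma derive_cst0 V W (c : W) v : 'D_v (cst c : V -> W) = cst 0.
Proof. by apply/funext => x; rewrite derive_cst. Qed.

Lemma smooth_cst V W (c : W) : smooth (cst c : V -> W).
Proof.
apply: (@smooth_ind _ _ (fun f => exists c, f = cst c)); last by exists c.
move=> _ [d ->]; split=> [x|x v|v]; [exact: cvg_cst|exact: derivable_cst|].
by exists 0; exact: derive_cst0.
Qed.

(** * Algebra of smooth functions *)

Lemma CkD V W k (f g : V -> W) :
  Ck k setT f -> Ck k setT g -> Ck k setT (f + g).
Proof.
elim: k f g => [|k IHk] f g [cf df] [cg dg]; (split; [|try exact: I]).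
1,2: by move=> x _; apply: continuousD; [exact: cf|exact: cg].
move=> v; have [dfv Dfv] := df v; have [dgv Dgv] := dg v.
split=> [x _|]; first by apply: derivableD; [exact: dfv|exact: dgv].
suff -> : 'D_v (f + g) = 'D_v f + 'D_v g by exact: IHk.
by apply/funext => x; rewrite deriveD//; [exact: dfv|exact: dgv].
Qed.

Lemma CkZ V W k (a : R) (f : V -> W) : Ck k setT f -> Ck k setT (a *: f).
Proof.
elim: k f => [|k IHk] f [cf df]; (split; [|try exact: I]).
1,2: by move=> x _; apply: continuousZr; exact: cf.
move=> v; have [dfv Dfv] := df v.
split=> [x _|]; first by apply: derivableZ; exact: dfv.
suff -> : 'D_v (a *: f) = a *: 'D_v f by exact: IHk.
by apply/funext => x; rewrite deriveZ//; exact: dfv.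
Qed.

Lemma CkM V k (f g : V -> R) :
  Ck k setT f -> Ck k setT g -> Ck k setT (f * g).
Proof.
elim: k f g => [|k IHk] f g Cf Cg; have [cf df] := Cf; have [cg dg] := Cg;
  (split; [|try exact: I]).
1,2: by move=> x _; apply: continuousM; [exact: cf|exact: cg].
move=> v; have [dfv Dfv] := df v; have [dgv Dgv] := dg v.
split=> [x _|]; first by apply: derivableM; [exact: dfv|exact: dgv].
suff -> : 'D_v (f * g) = f * 'D_v g + g * 'D_v f.
  by apply: CkD; apply: IHk => //; exact: CkW.
by apply/funext => x; rewrite deriveM//; [exact: dfv|exact: dgv].
Qed.

(** The derivative of [1/f] is [- (1/f)^2 f'], so order [k] for [1/f] itself yields order [k.+1]. *)
Lemma CkV V k (f : V -> R) :
  (forall x, f x != 0) -> Ck k setT f -> Ck k setT (fun x => (f x)^-1).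
Proof.
move=> f0; elim: k => [|k IHk] Cf; have [cf df] := Cf; (split; [|try exact: I]).
1,2: by move=> x _; apply: cvgV => //; exact: cf.
move=> v; have [dfv Dfv] := df v.
split=> [x _|]; first by apply: derivableV => //; exact: dfv.
set h := fun x => (f x)^-1.
suff -> : 'D_v h = (-1) *: ((h * h) * 'D_v f).
  by apply/CkZ/CkM => //; apply: CkM; exact/IHk/CkW.
apply/funext => x; rewrite deriveV//; last exact: dfv.
rewrite -[RHS]/(-1 * ((f x)^-1 * (f x)^-1 * 'D_v f x)).
by rewrite -[LHS]/(- f x ^- 2 * 'D_v f x) expr2 invfM; ring.
Qed.

Lemma smoothD V W (f g : V -> W) : smooth f -> smooth g -> smooth (f + g).
Proof. by move=> sf sg k; exact: CkD. Qed.

Lemma smoothZ V W a (f : V -> W) : smooth f -> smooth (a *: f).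
Proof. by move=> sf k; exact: CkZ. Qed.

Lemma smoothN V W (f : V -> W) : smooth f -> smooth (- f).
Proof. by move=> sf; rewrite -scaleN1r; exact: smoothZ. Qed.

Lemma smoothB V W (f g : V -> W) : smooth f -> smooth g -> smooth (f - g).
Proof. by move=> sf sg; apply: smoothD => //; exact: smoothN. Qed.

Lemma smoothM V (f g : V -> R) : smooth f -> smooth g -> smooth (f * g).
Proof. by move=> sf sg k; exact: CkM. Qed.

Lemma smoothV V (f : V -> R) :
  (forall x, f x != 0) -> smooth f -> smooth (fun x => (f x)^-1).
Proof. by move=> f0 sf k; exact: CkV. Qed.

Lemma smooth_sum V W (I : Type) (r : seq I) (f : I -> V -> W) :
  (forall i, smooth (f i)) -> smooth (fun x => \sum_(i <- r) f i x).
Proof.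
move=> sf; rewrite [X in smooth X](_ : _ = \sum_(i <- r) f i); last first.
  by apply/funext => x; rewrite fct_sumE.
apply: (big_ind (fun g : V -> W => smooth g)) => //; last exact: smoothD.
exact: (@smooth_cst V W 0).
Qed.

(** * Composition with affine maps *)

Section AffineComposition.
Context V1 V2 W (L L0 : V1 -> V2).
(** [L] is affine with linear part [L0], in the shape that occurs in a difference quotient;
    derivatives of [f \o L] are then obtained by rewriting, without a chain rule. *)
Hypothesis LE : forall h v x, L (h *: v + x) = h *: L0 v + L x.

Lemma derivable_affine (f : V2 -> W) x v :
  derivable f (L x) (L0 v) -> derivable (f \o L) x v.
Proof.
by rewrite /derivable /=; under [in X in _ -> X]eq_fun do rewrite LE.
Qed.

Lemma derive_affine (f : V2 -> W) x v :
  'D_v (f \o L) x = 'D_(L0 v) f (L x).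
Proof. by rewrite /derive /=; under eq_fun do rewrite LE. Qed.

Lemma smooth_affine (f : V2 -> W) :
  continuous L -> smooth f -> smooth (f \o L).
Proof.
move=> cL sf k; elim: k f sf => [|k IHk] f sf.
all: have cfL : forall x : V1, setT x -> {for x, continuous (f \o L)} by
  move=> x _; apply: continuous_comp; [exact: cL|exact: smooth_continuous].
all: split=> // v.
split=> [x _|]; first exact/derivable_affine/smooth_derivable.
suff -> : 'D_v (f \o L) = 'D_(L0 v) f \o L by exact/IHk/smooth_derive.
by apply/funext => x; exact: derive_affine.
Qed.

End AffineComposition.

Lemma continuous_addr V (a : V) : continuous (fun x => x + a).
Proof. by move=> x; apply: cvgD => //; exact: cvg_cst. Qed.

Lemma smooth_shift V W (f : V -> W) a : smooth f -> smooth (fun x => f (x + a)).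
Proof.
apply: (@smooth_affine _ _ _ (fun x => x + a) id) => [h v x|];
  [by rewrite addrA|exact: continuous_addr].
Qed.

Lemma derive_comp_shift V W (f : V -> W) a x v :
  'D_v (fun y => f (y + a)) x = 'D_v f (x + a).
Proof.
have LE h (w y : V) : h *: w + y + a = h *: w + (y + a) by rewrite addrA.
exact: (derive_affine (L := +%R^~ a) (L0 := id) LE f).
Qed.

Lemma smooth_linear V W (L : {linear V -> W}) : continuous L -> smooth L.
Proof.
move=> cL k; have dL x v : is_derive x v L (L v).
  have dLx : differentiable L x by exact: linear_differentiable.
  by apply: DeriveDef; [exact: diff_derivable|rewrite deriveE// diff_lin].
case: k => [|k]; (split; [by move=> x _; exact: cL|try exact: I]).
move=> v; split=> [x _|]; first exact: ex_derive.
suff -> : 'D_v L = cst (L v) by exact: smooth_cst.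
by apply/funext => x; rewrite derive_val.
Qed.

(** * Derivatives along lines and partial derivatives *)

Lemma derive_line V W (f : V -> W) x v (t : R) : derivable f (t *: v + x) v ->
  is_derive t 1 (fun s => f (s *: v + x)) ('D_v f (t *: v + x)).
Proof.
pose L (s : R) : V := s *: v + x.
have LE h (w s : R) : L (h *: w + s) = h *: (w *: v) + L s.
  by rewrite /L scalerDl -scalerA addrA.
move=> df; apply: DeriveDef.
  by apply: (derivable_affine LE); rewrite scale1r.
by rewrite -[LHS]/('D_1 (f \o L) t) (derive_affine LE) scale1r.
Qed.

Lemma line_MVT V (f : V -> R) x v (h : R) : smooth f ->
  exists2 c : R, `|c| <= `|h| & f (h *: v + x) - f x = 'D_v f (c *: v + x) * h.
Proof.
move=> sf; pose F s := f (s *: v + x).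
have dF (s : R) : is_derive s 1 F ('D_v f (s *: v + x)).
  by apply: derive_line; exact: smooth_derivable.
have cF (a b : R) : {within `[a, b], continuous F}.
  apply: continuous_subspaceT => s; apply: differentiable_continuous.
  by apply/derivable1_diffP; exact: ex_derive.
have F0 : F 0 = f x by rewrite /F scale0r add0r.
have [h0|h0] := leP 0 h.
  have [c + E] := MVT_segment h0 (fun s _ => dF s) (cF 0 h).
  rewrite in_itv/= => /andP[c0 ch]; exists c; first by rewrite !ger0_norm.
  by move: E; rewrite F0 subr0.
have [c + E] := MVT_segment (ltW h0) (fun s _ => dF s) (cF h 0).
rewrite in_itv/= => /andP[ch c0]; exists c.
  by rewrite !ler0_norm ?lerN2// ltW.
by apply: oppr_inj; rewrite opprB -F0 E sub0r mulrN.
Qed.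

(* The increment between [x + h v] and [x + h v + h u] is, by the mean value
   theorem, [h] times a value of ['D_u f] at a point tending to [x]. *)
Lemma deriveDv V (f : V -> R) x u v : smooth f ->
  'D_(u + v) f x = 'D_u f x + 'D_v f x.
Proof.
move=> sf; apply: cvg_lim => //=.
have -> : (fun h : R => h^-1 *: (f (h *: (u + v) + x) - f x)) =
    (fun h => h^-1 *: (f (h *: u + (h *: v + x)) - f (h *: v + x))) +
    (fun h => h^-1 *: (f (h *: v + x) - f x)).
  apply/funext => h; rewrite -[RHS]/(_ *: _ + _ *: _) -scalerDr.
  have -> : h *: (u + v) + x = h *: u + (h *: v + x) by rewrite scalerDr addrA.
  by rewrite subrKA.
apply: cvgD; last exact: smooth_derivable.
apply/cvgrPdist_lt => e e0.
pose G (z : R * R) := z.1 *: u + (z.2 *: v + x).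
have cG : {for (0, 0), continuous ('D_u f \o G)}.
  apply: continuous_comp; last exact/smooth_continuous/smooth_derive.
  apply: cvgD; first by apply: cvgZr_tmp; exact: cvg_fst.
  by apply: cvgD; [apply: cvgZr_tmp; exact: cvg_snd|exact: cvg_cst].
have /cvgrPdist_lt/(_ e e0)[[A B] /= [A0 B0] AB] := cG.
move: A0 B0 => /nbhs_ballP[r /= r0 rA] /nbhs_ballP[r' /= r'0 rB].
near=> h.
have [c ch ->] := line_MVT (h *: v + x) u h sf.
have h0 : h != 0 by near: h; exact: nbhs_dnbhs_neq.
rewrite /GRing.scale/= mulrC mulfK//.
have := AB (c, h); rewrite /= /G/= !scale0r !add0r; apply; split.
  apply: rA; rewrite -ball_normE/= sub0r normrN (le_lt_trans ch)//.
  by near: h; exact: dnbhs0_lt.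
apply: rB; rewrite -ball_normE/= sub0r normrN.
by near: h; exact: dnbhs0_lt.
Unshelve. all: by end_near. Qed.

(** On the line through [x] in direction [v] the function has one variable, so its derivative there
    is a differential and hence linear. *)
Lemma deriveZv V W (f : V -> W) x (a : R) v : derivable f x v ->
  'D_(a *: v) f x = a *: 'D_v f x.
Proof.
move=> df; pose L (s : R) : V := s *: v + x.
have LE h (w s : R) : L (h *: w + s) = h *: (w *: v) + L s.
  by rewrite /L scalerDl -scalerA addrA.
have L0 : L 0 = x by rewrite /L scale0r add0r.
have dfL : differentiable (f \o L) 0.
  by apply/derivable1_diffP/(derivable_affine LE); rewrite scale1r L0.
have E w : 'D_(w *: v) f x = 'D_w (f \o L) 0.
  by rewrite (derive_affine LE) L0.
by rewrite E -[v in RHS]scale1r E !deriveE// -[a in LHS]mulr1 linearZ.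
Qed.

Lemma derive_coord m (f : 'rV[R]_m -> R) v x : smooth f ->
  'D_v f x = \sum_i v 0 i * partial i f x.
Proof.
move=> sf; rewrite {1}[v]row_sum_delta.
elim/big_ind2 : _ => [|u a w b <- <-|i _]; first exact: derive0.
  exact: deriveDv.
by rewrite deriveZv//; exact: smooth_derivable.
Qed.

Lemma smooth_partial m i (f : 'rV[R]_m -> R) : smooth f -> smooth (partial i f).
Proof. exact: smooth_derive. Qed.

Lemma partial0_cst m (f : 'rV[R]_m -> R) : smooth f ->
  (forall i x, partial i f x = 0) -> forall x, f x = f 0.
Proof.
move=> sf f0 x; have [c _] := line_MVT 0 x 1 sf.
rewrite scale1r addr0 derive_coord// big1 ?mul0r => [/subr0_eq//|i _].
by rewrite f0 mulr0.
Qed.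

(** Forward: the entries of smooth matrix functions form a class stable under ['D_v]. Backward:
    continuity is checked in the sup norm over finitely many entries, and ['D_v] acts entrywise. *)
Lemma smooth_mxP V m n (F : V -> 'M[R]_(m, n)) :
  smooth F <-> forall i j, smooth (fun x => F x i j).
Proof.
split=> [sF i j|sF k].
  pose P (f : V -> R) := exists2 F : V -> 'M[R]_(m, n), smooth F &
    f = fun x => F x i j.
  apply: (@smooth_ind V R P); last by exists F.
  move=> _ {sF}[{}F sF ->]; split=> [x|x v|v].
  - apply: (@continuous_comp _ _ _ F (fun M : 'M[R]_(m, n) => M i j)).
      exact: smooth_continuous.
    exact: coord_continuous.
  - by have /derivable_mxP := @smooth_derivable _ _ _ x v sF; exact.
  - exists ('D_v F); first exact: smooth_derive.
    apply/funext => x; rewrite derive_mx ?mxE//; exact: smooth_derivable.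
elim: k F sF => [|k IHk] F sF; (split; [|try exact: I]).
1,2: move=> x _; apply/cvgrPdist_le => e e0; near=> y.
1,2: rewrite [leLHS]/Num.Def.normr/= mx_normrE (bigmax_le _ (ltW e0))//= => i _.
1,2: rewrite !mxE; move: i; near: y; apply: filter_forall => -[i j] /=.
1,2: by apply: (cvgrPdist_le _ _).1 => //; exact: (smooth_continuous (sF i j)).
have dF x v : derivable F x v.
  by apply/derivable_mxP => i j; exact: smooth_derivable.
move=> v; split=> [x _|]; first exact: dF.
apply: IHk => i j.
have -> : (fun x => 'D_v F x i j) = 'D_v (fun x => F x i j).
  by apply/funext => x; rewrite derive_mx ?mxE.
exact: smooth_derive.
Unshelve. all: by end_near. Qed.

Lemma derive_mxE V m n (F : V -> 'M[R]_(m, n)) v x i j : smooth F ->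
  ('D_v F x) i j = 'D_v (fun y => F y i j) x.
Proof. by move=> sF; rewrite derive_mx ?mxE//; exact: smooth_derivable. Qed.

(** The span of sine and cosine is stable under differentiation. *)
Lemma smooth_sin : smooth (sin : R -> R).
Proof.
pose P (f : R -> R) := exists a b : R, f = a *: sin + b *: cos.
apply: (@smooth_ind _ _ P); last first.
  by exists 1, 0; rewrite scale1r scale0r addr0.
move=> _ [a [b ->]].
have df x : derivable (a *: sin + b *: cos : R -> R) x 1.
  by apply: derivableD; apply: derivableZ.
split=> [x|x v|v].
- exact/differentiable_continuous/derivable1_diffP.
- exact/diff_derivable/derivable1_diffP.
exists (- (v * b)), (v * a); apply/funext => x.
rewrite -[v in LHS]mulr1 -[_ * _]/(_ *: _) deriveZv//.
rewrite deriveD ?deriveZ//; try exact: derivableZ.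
rewrite !derive_val /=.
rewrite -[LHS]/(v * (a * cos x + b * - sin x)).
rewrite -[RHS]/(- (v * b) * sin x + v * a * cos x); ring.
Qed.

End SmoothFunctions.

(** * Averages over translations and exactness *)

Section UnitIntegral.
Context {R : realType}.
Implicit Types f g : R -> R.

Definition itg f : R := \int[lebesgue_measure]_(r in `[0, 1]) f r.

Lemma integrable01 f : continuous f ->
  (@lebesgue_measure R).-integrable `[0, 1] (EFin \o f).
Proof.
move=> cf; apply: continuous_compact_integrable; first exact: segment_compact.
exact: continuous_subspaceT.
Qed.

Lemma itgD f g : continuous f -> continuous g ->
  itg (fun r => f r + g r) = itg f + itg g.
Proof. by move=> cf cg; apply: RintegralD => //; exact: integrable01. Qed.

Lemma itgB f g : continuous f -> continuous g ->
  itg (fun r => f r - g r) = itg f - itg g.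
Proof. by move=> cf cg; apply: RintegralB => //; exact: integrable01. Qed.

Lemma itgZ a f : continuous f -> itg (fun r => a * f r) = a * itg f.
Proof. by move=> cf; apply: RintegralZl => //; exact: integrable01. Qed.

Lemma itg_cst a : itg (fun=> a) = a.
Proof.
rewrite /itg Rintegral_cst//=.
by rewrite lebesgue_measure_itv/= lte_fin ltr01 oppr0 adde0 mulr1.
Qed.

Lemma eq_itg f g : (forall r, 0 <= r <= 1 -> f r = g r) -> itg f = itg g.
Proof.
by move=> fg; apply: eq_Rintegral => r /set_mem; rewrite /= in_itv/=; exact: fg.
Qed.

Lemma le_norm_itg f e : continuous f ->
  (forall r, 0 <= r <= 1 -> `|f r| <= e) -> `|itg f| <= e.
Proof.
move=> cf fe; have cNf : continuous (fun r => `|f r|).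
  by move=> r; apply: continuous_comp (cf r) _; exact: norm_continuous.
apply: le_trans (le_normr_Rintegral _ (integrable01 cf)) _ => //.
rewrite -[leRHS]itg_cst; apply: le_Rintegral => //=.
- exact: integrable01.
- by apply: integrable01 => r; exact: cvg_cst.
Qed.

Lemma itg_derive f g : continuous g -> (forall r : R, is_derive r 1 f (g r)) ->
  itg g = f 1 - f 0.
Proof.
move=> cg fg; rewrite /itg /Rintegral (@continuous_FTC2 _ g f)//.
- exact: continuous_subspaceT.
- have cf : continuous f.
    move=> r; apply: differentiable_continuous.
    by apply/derivable1_diffP; exact: ex_derive.
  split=> [r _||]; first exact: ex_derive.
    by apply: cvg_at_right_filter; exact: cf.
  by apply: cvg_at_left_filter; exact: cf.
- by move=> r _; rewrite derive1E derive_val.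
Qed.

(** Compactness of the segment makes continuity at the points [(r, y0)] uniform in [r], which lets
    limits and derivatives pass under the integral. Both values are compared with [G] at a nearby
    [(r, y0)], whence [e / 2]. *)
Lemma segment_uniform (Y : topologicalType) (G : R -> Y -> R) y0 (e : R) :
  0 < e -> (forall r : R, {for (r, y0), continuous (fun z => G z.1 z.2)}) ->
  \forall y \near y0, forall r, 0 <= r <= 1 -> `|G r y0 - G r y| < e.
Proof.
move=> e0 cG; have e20 : 0 < e / 2 by rewrite divr_gt0.
have /compact_near_coveringP cov : compact (`[0, 1]%classic : set R).
  exact: segment_compact.
have : \forall y \near y0,
    `[0, 1]%classic `<=` (fun r => `|G r y0 - G r y| < e).
  apply: cov => r _.
  have /cvgrPdist_lt/(_ _ e20)[[A B] /= [A0 B0] AB] := cG r.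
  exists (A, B) => // -[r' y] [/= Ar' By].
  rewrite -(subrKA (G r y0)) (le_lt_trans (ler_normD _ _))// (splitr e) ltrD//.
    rewrite distrC; apply: (AB (r', y0)); split => //=.
    exact: nbhs_singleton B0.
  exact: (AB (r', y)).
apply: filterS => y sub r r01; apply: sub.
by rewrite /= in_itv.
Qed.

End UnitIntegral.

(** * Weighted averages along a direction *)

Section TranslationAverage.
Context {R : realType} {V : normedModType R}.
Implicit Types (f : V -> R) (w : R -> R) (e v x : V).

Definition wavg w e f x : R := itg (fun r => w r * f (r *: e + x)).

Lemma continuous_line f e x : continuous f ->
  continuous (fun r : R => f (r *: e + x)).
Proof.
move=> cf r; apply: (@continuous_comp _ _ _ (fun r : R => r *: e + x)).
  by apply: cvgD; [apply: cvgZr_tmp; exact: cvg_id|exact: cvg_cst].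
exact: cf.
Qed.

Lemma continuous_wline w f e x : continuous w -> continuous f ->
  continuous (fun r : R => w r * f (r *: e + x)).
Proof.
by move=> cw cf r; apply: continuousM; [exact: cw|exact: continuous_line].
Qed.

Section Weight.
Context (w : R -> R).
Hypotheses (cw : continuous w) (w1 : forall r, 0 <= r <= 1 -> `|w r| <= 1).

Lemma le_norm_itgw (f g : R -> R) d : continuous f -> continuous g ->
  (forall r, 0 <= r <= 1 -> `|f r - g r| <= d) ->
  `|itg (fun r => w r * f r) - itg (fun r => w r * g r)| <= d.
Proof.
move=> cf cg fg; rewrite -itgB.
- apply: le_norm_itg => [r|r r01].
    apply: cvgB; apply: cvgM; [exact: cw|exact: cf|exact: cw|exact: cg].
  rewrite -mulrBr normrM -[leRHS]mul1r ler_pM//; [exact: w1|exact: fg].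
- by move=> r; apply: continuousM; [exact: cw|exact: cf].
- by move=> r; apply: continuousM; [exact: cw|exact: cg].
Qed.

Lemma continuous_wavg e f : continuous f -> continuous (wavg w e f).
Proof.
move=> cf x; apply/cvgrPdist_le => d d0.
have unif := @segment_uniform R V (fun r y => f (r *: e + y)) x d d0.
suff /unif : forall r : R, {for (r, x),
    continuous (fun z : R * V => f (z.1 *: e + z.2))}.
  apply: filterS => y xy; apply: le_norm_itgw; try exact: continuous_line.
  by move=> r /xy/ltW.
move=> r; apply: (@continuous_comp _ _ _ (fun z : R * V => z.1 *: e + z.2)).
  by apply: cvgD; [apply: cvgZr_tmp; exact: cvg_fst|exact: cvg_snd].
exact: cf.
Qed.

(** Differentiation under the integral sign: by the mean value theorem the difference quotient at
    [r] is a value of ['D_v f] near [r *: e + x], and [segment_uniform] makes the approximation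
    uniform in [r]. *)
Lemma is_derive_wavg e f x v : smooth f ->
  is_derive x v (wavg w e f) (wavg w e ('D_v f) x).
Proof.
move=> sf; have cf := smooth_continuous sf.
have cDf := smooth_continuous (smooth_derive v sf).
suff lim_wavg : h^-1 *: (wavg w e f (h *: v + x) - wavg w e f x) @[h --> 0^']
    --> wavg w e ('D_v f) x.
  by apply: DeriveDef; [apply/cvg_ex; eexists; exact: lim_wavg|exact: cvg_lim].
apply/cvgrPdist_le => d d0.
pose G (r t : R) := 'D_v f (t *: v + (r *: e + x)).
have unif : \forall t \near (0 : R), forall r, 0 <= r <= 1 ->
    `|G r 0 - G r t| < d.
  apply: segment_uniform => // r.
  apply: (@continuous_comp _ _ _
    (fun z : R * R => z.2 *: v + (z.1 *: e + x)) ('D_v f)); last exact: cDf.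
  apply: cvgD; first by apply: cvgZr_tmp; exact: cvg_snd.
  by apply: cvgD; [apply: cvgZr_tmp; exact: cvg_fst|exact: cvg_cst].
have [/= d' d'0 unif'] := (@nbhs_ballP _ _ _ _).1 unif.
near=> h.
have h0 : h != 0 by near: h; exact: nbhs_dnbhs_neq.
have hd' : `|h| < d' by near: h; exact: dnbhs0_lt.
have cl y := @continuous_line f e y cf.
pose q r := h^-1 * (f (r *: e + (h *: v + x)) - f (r *: e + x)).
have cq : continuous q.
  move=> r; apply: cvgM; first exact: cvg_cst.
  by apply: cvgB; exact: cl.
suff -> : h^-1 *: (wavg w e f (h *: v + x) - wavg w e f x) =
    itg (fun r => w r * q r).
  apply: (@le_norm_itgw (fun r => 'D_v f (r *: e + x)) q) => //.
    exact: (@continuous_line ('D_v f)).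
  move=> r r01; have [c ch] := line_MVT (r *: e + x) v h sf.
  rewrite addrCA => E; rewrite /q E mulrC mulfK//.
  have := unif' c _ r r01; rewrite /G scale0r add0r => /(_ _)/ltW; apply.
  by rewrite /= -ball_normE /= sub0r normrN (le_lt_trans ch).
rewrite /wavg -itgB; try exact: continuous_wline.
rewrite -[LHS]itgZ => [|r].
  by apply: eq_itg => r _; rewrite -mulrBr mulrCA.
by apply: cvgB; exact: continuous_wline.
Unshelve. all: by end_near. Qed.

Lemma derive_wavg e f v : smooth f ->
  'D_v (wavg w e f) = wavg w e ('D_v f).
Proof. by move=> sf; apply/funext => x; case: (is_derive_wavg e x v sf). Qed.

Lemma smooth_wavg e f : smooth f -> smooth (wavg w e f).
Proof.
move=> sf; apply: (@smooth_ind _ _ _ (fun g => exists2 f, smooth f &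
  g = wavg w e f)); last by exists f.
move=> _ {sf}[{}f sf ->]; split=> [|x v|v].
- exact/continuous_wavg/smooth_continuous.
- by case: (is_derive_wavg e x v sf).
- by exists ('D_v f); [exact: smooth_derive|rewrite derive_wavg].
Qed.

Lemma wavgD e f g : continuous f -> continuous g ->
  wavg w e (f + g) = wavg w e f + wavg w e g.
Proof.
move=> cf cg; apply/funext => x; rewrite -[RHS]/(_ x + _ x) /wavg -itgD.
- by apply: eq_itg => r _; rewrite -mulrDr.
- exact: continuous_wline.
- exact: continuous_wline.
Qed.

Lemma wavgZ a e f : continuous f -> wavg w e (a *: f) = a *: wavg w e f.
Proof.
move=> cf; apply/funext => x; rewrite -[RHS]/(a * _ x) /wavg -itgZ.
- by apply: eq_itg => r _; rewrite mulrCA.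
- exact: continuous_wline.
Qed.

End Weight.

(* With the weight [1 - r], [primitive e f] solves
   ['D_e (primitive e f) = avg e f - f], see [primitive_derive]; unlike a
   primitive from a base point, it is periodic when [f] is. *)
Definition avg := wavg (cst 1).
Definition primitive := wavg (fun r => 1 - r).

Let w1 (r : R) : 0 <= r <= 1 -> `|cst 1 r : R| <= 1.
Proof. by rewrite normr1. Qed.

Let cw1 : continuous (cst 1 : R -> R).
Proof. by move=> r; exact: cvg_cst. Qed.

Let w1B (r : R) : 0 <= r <= 1 -> `|1 - r| <= 1.
Proof. by move=> /andP[r0 r1]; rewrite ger0_norm; lra. Qed.

Let cw1B : continuous (fun r : R => 1 - r).
Proof. by move=> r; apply: cvgB; [exact: cvg_cst|exact: cvg_id]. Qed.

Lemma smooth_avg e f : smooth f -> smooth (avg e f).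
Proof. exact: smooth_wavg. Qed.

Lemma derive_avg e f v : smooth f -> 'D_v (avg e f) = avg e ('D_v f).
Proof. exact: derive_wavg. Qed.

Lemma avgD e f g : smooth f -> smooth g -> avg e (f + g) = avg e f + avg e g.
Proof. by move=> /smooth_continuous cf /smooth_continuous cg; exact: wavgD. Qed.

Lemma avgZ a e f : smooth f -> avg e (a *: f) = a *: avg e f.
Proof. by move=> /smooth_continuous cf; exact: wavgZ. Qed.

Lemma smooth_primitive e f : smooth f -> smooth (primitive e f).
Proof. exact: smooth_wavg. Qed.

Lemma derive_primitive e f v : smooth f ->
  'D_v (primitive e f) = primitive e ('D_v f).
Proof. exact: derive_wavg. Qed.

Lemma primitiveD e f g : smooth f -> smooth g ->
  primitive e (f + g) = primitive e f + primitive e g.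
Proof. by move=> /smooth_continuous cf /smooth_continuous cg; exact: wavgD. Qed.

Lemma primitiveZ a e f : smooth f -> primitive e (a *: f) = a *: primitive e f.
Proof. by move=> /smooth_continuous cf; exact: wavgZ. Qed.

Lemma avg_derive e f x : smooth f -> avg e ('D_e f) x = f (e + x) - f x.
Proof.
move=> sf; have df (r : R) : is_derive r 1 (fun r => f (r *: e + x))
    (1 * 'D_e f (r *: e + x)).
  by rewrite mul1r; apply: derive_line; exact: smooth_derivable.
rewrite /avg /wavg (itg_derive _ df) ?scale1r ?scale0r ?add0r//.
by apply: (@continuous_wline (cst 1) ('D_e f)) => //;
  exact/smooth_continuous/smooth_derive.
Qed.

(** Integration by parts: [(1 - r) f(r e + x)] equals [f x] at [r = 0], vanishes at [r = 1], and has
    derivative [(1 - r) 'D_e f - f] along the line. *)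
Lemma primitive_derive e f x : smooth f ->
  primitive e ('D_e f) x = avg e f x - f x.
Proof.
move=> sf; rewrite /primitive /avg /wavg.
have cf := smooth_continuous sf.
have cDf := smooth_continuous (smooth_derive e sf).
apply/eqP; rewrite -subr_eq0 opprB addrCA -itgB; first last.
- exact: (@continuous_wline (cst 1) f).
- exact: (@continuous_wline (fun r => 1 - r) ('D_e f)).
have d (r : R) : is_derive r 1 (fun r => (1 - r) * f (r *: e + x))
    ((1 - r) * 'D_e f (r *: e + x) - 1 * f (r *: e + x)).
  have df : is_derive r 1 (fun r => f (r *: e + x)) ('D_e f (r *: e + x)).
    by apply: derive_line; exact: smooth_derivable.
  have d1 : is_derive r 1 (fun r : R => 1 - r) (0 - 1) by exact: is_deriveB.
  apply: (is_derive_eq (is_deriveM d1 df)).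
  rewrite -[LHS]/(_ * _ + _ * _); ring.
rewrite (itg_derive _ d).
- by rewrite scale0r add0r; apply/eqP; ring.
- move=> r; apply: cvgB.
    exact: (@continuous_wline (fun r => 1 - r) ('D_e f)).
  exact: (@continuous_wline (cst 1) f).
Qed.

End TranslationAverage.

(** * Periodic functions and periodic 2-forms *)

Section PeriodicForms.
Context {R : realType} {m : nat}.
Notation V := 'rV[R]_m.
Implicit Types (f g : V -> R) (s : seq 'I_m) (i j k : 'I_m).

Definition periodic T (F : V -> T) : Prop :=
  forall x (z : 'rV[int]_m), F (x + map_mx intr z) = F x.

Lemma periodic_delta T (F : V -> T) i x :
  periodic F -> F (delta_mx 0 i + x) = F x.
Proof.
by move=> pF; rewrite -(pF x (delta_mx 0 i)) map_delta_mx addrC.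
Qed.

Lemma periodic_wavg w e f : periodic f -> periodic (wavg w e f).
Proof. by move=> pf x z; apply: eq_itg => r _; rewrite addrA pf. Qed.

Lemma partialD i f g : smooth f -> smooth g ->
  partial i (f + g) = partial i f + partial i g.
Proof.
move=> sf sg; apply/funext => x.
by rewrite /partial deriveD//; exact: smooth_derivable.
Qed.

Lemma partialZ i a f : smooth f -> partial i (a *: f) = a *: partial i f.
Proof.
move=> sf; apply/funext => x.
by rewrite /partial deriveZ//; exact: smooth_derivable.
Qed.

Lemma partialN i f : smooth f -> partial i (- f) = - partial i f.
Proof. by move=> sf; rewrite -scaleN1r partialZ// scaleN1r. Qed.

Lemma partialB i f g : smooth f -> smooth g ->
  partial i (f - g) = partial i f - partial i g.
Proof. by move=> sf sg; rewrite partialD ?partialN//; exact: smoothN. Qed.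

Lemma partial_cst i (c : R) : partial i (cst c : V -> R) = 0.
Proof. by apply/funext => x; rewrite /partial derive_cst. Qed.

Definition avgs s f : V -> R := foldr (fun i => avg (delta_mx 0 i)) f s.

Lemma smooth_avgs s f : smooth f -> smooth (avgs s f).
Proof. by move=> sf; elim: s => //= i s; exact: smooth_avg. Qed.

Lemma periodic_avgs s f : periodic f -> periodic (avgs s f).
Proof. by move=> pf; elim: s => //= i s; exact: periodic_wavg. Qed.

Lemma avgsD s f g : smooth f -> smooth g ->
  avgs s (f + g) = avgs s f + avgs s g.
Proof.
by move=> sf sg; elim: s => //= i s ->; rewrite avgD//; exact: smooth_avgs.
Qed.

Lemma avgsZ s a f : smooth f -> avgs s (a *: f) = a *: avgs s f.
Proof.
by move=> sf; elim: s => //= i s ->; rewrite avgZ//; exact: smooth_avgs.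
Qed.

Lemma avgsN s f : smooth f -> avgs s (- f) = - avgs s f.
Proof. by move=> sf; rewrite -scaleN1r avgsZ// scaleN1r. Qed.

Lemma avg_cst e (c : R) : avg e (cst c : V -> R) = cst c.
Proof.
apply/funext => x; rewrite /avg /wavg -[RHS]itg_cst.
by apply: eq_itg => r _; rewrite mul1r.
Qed.

Lemma avgs_cst s (c : R) : avgs s (cst c) = cst c.
Proof. by elim: s => //= i s ->; exact: avg_cst. Qed.

Lemma partial_avgs i s f : smooth f ->
  partial i (avgs s f) = avgs s (partial i f).
Proof.
move=> sf; elim: s => //= j s <-.
by rewrite /partial derive_avg//; exact: smooth_avgs.
Qed.

(** The average of [partial i f] over one period in direction [i] is the increment of [f] over that
    period, hence zero; the other averages commute with [partial i]. *)
Lemma partial_avgs0 i s f : smooth f -> periodic f -> i \in s ->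
  partial i (avgs s f) = 0.
Proof.
move=> sf pf; elim: s => //= j s IHs; rewrite in_cons => is0.
rewrite /partial derive_avg; last exact: smooth_avgs.
have [<-|ji] := eqVneq i j.
  apply/funext => x; rewrite avg_derive; last exact: smooth_avgs.
  by rewrite periodic_delta ?subrr//; exact: periodic_avgs.
rewrite (negbTE ji)/= in is0.
by rewrite -/(partial i _) IHs// (avg_cst _ 0).
Qed.

(** Evaluation at [0] involves no choice when [f] is smooth and periodic, by [avgs_mean]. *)
Definition mean f : R := avgs (enum 'I_m) f 0.

Lemma avgs_mean f x : smooth f -> periodic f -> avgs (enum 'I_m) f x = mean f.
Proof.
move=> sf pf; apply: partial0_cst => [|i y]; first exact: smooth_avgs.
by rewrite partial_avgs0// mem_enum.
Qed.

Lemma meanD f g : smooth f -> smooth g -> mean (f + g) = mean f + mean g.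
Proof. by move=> sf sg; rewrite /mean avgsD. Qed.

Lemma meanZ a f : smooth f -> mean (a *: f) = a * mean f.
Proof. by move=> sf; rewrite /mean avgsZ. Qed.

Lemma mean_cst (c : R) : mean (cst c) = c.
Proof. by rewrite /mean avgs_cst. Qed.

Lemma mean_partial i f : smooth f -> periodic f -> mean (partial i f) = 0.
Proof.
by move=> sf pf; rewrite /mean -partial_avgs// partial_avgs0// mem_enum.
Qed.

(** * Closed periodic 2-forms are cohomologous to constant forms *)

Section Poincare.
Context (f : 'I_m -> 'I_m -> V -> R).
Hypotheses (sf : forall i j, smooth (f i j))
  (pf : forall i j, periodic (f i j))
  (skewf : forall i j, f j i = - f i j)
  (closedf : forall i j k,
    partial i (f j k) + partial j (f k i) + partial k (f i j) = 0).

(* One averaging step in direction [i]: by Cartan's formula, [f - avg_i f] is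
   the differential of the 1-form with coefficients [primitive e_i (f k i)]. *)
Lemma sub_avgs_exact s : exists b : 'I_m -> V -> R,
  [/\ forall i, smooth (b i), forall i, periodic (b i) &
      forall i j, f i j - avgs s (f i j) = partial i (b j) - partial j (b i)].
Proof.
elim: s => [|i s [b [sb pb Eb]]].
  exists (fun=> cst 0); split=> [i|i|i j]; first exact: smooth_cst.
    by move=> x z.
  by rewrite !partial_cst subr0; apply/funext => x; exact: subrr.
pose g j k := avgs s (f j k).
have sg j k : smooth (g j k) by exact: smooth_avgs.
pose e : V := delta_mx 0 i.
exists (fun k => b k + primitive e (g k i)); split=> [k|k|j k].
- by apply: smoothD => //; exact: smooth_primitive.
- by move=> x z; rewrite -[LHS]/(_ + _) pb [X in _ + X]periodic_wavg//;
    exact: periodic_avgs.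
have spg j' k' : smooth (primitive e (g j' k')) :=
  smooth_primitive e (sg j' k').
have dpg l j' k' : partial l (primitive e (g j' k')) =
    primitive e (partial l (g j' k')) := derive_primitive e _ (sg j' k').
have sdg l j' k' : smooth (partial l (g j' k')) := smooth_partial l (sg j' k').
rewrite (partialD j (sb k) (spg k i)) (partialD k (sb j) (spg j i)).
rewrite opprD addrACA -Eb -/(g j k) -[LHS](subrKA (g j k)); congr (_ + _).
have skewg : g j i = (-1) *: g i j by rewrite /g skewf scaleN1r avgsN.
rewrite !dpg skewg (partialZ k _ (sg i j)) (primitiveZ _ _ (sdg k i j)).
rewrite scaleN1r opprK -(primitiveD e (sdg j k i) (sdg k i j)).
(* Closedness replaces the two derivatives by minus the derivative in direction [i], which
   [primitive_derive] integrates. *)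
have -> : partial j (g k i) + partial k (g i j) = (-1) *: 'D_e (g j k).
  rewrite -/(partial i (g j k)) !partial_avgs ?scaleN1r; try exact: sf.
  have sdf l j' k' : smooth (partial l (f j' k')) :=
    smooth_partial l (sf j' k').
  rewrite -(avgsD _ (sdf j k i) (sdf k i j)).
  have /eqP := closedf i j k; rewrite -addrA addr_eq0 => /eqP ->.
  have sD : smooth (partial j (f k i) + partial k (f i j)) by exact: smoothD.
  by rewrite (avgsN _ sD) opprK.
rewrite (primitiveZ _ _ (sdg i j k)).
apply/funext => x; rewrite -[RHS]/(-1 * primitive e _ x).
by rewrite (primitive_derive _ _ (sg j k)) mulN1r opprB.
Qed.

(** Once all directions are averaged, the coefficients are the constant means. Periodicity of [b]
    makes it a 1-form on the torus. *)
Theorem sub_mean_exact : exists b : 'I_m -> V -> R,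
  [/\ forall i, smooth (b i), forall i, periodic (b i) &
      forall i j x,
        f i j x - mean (f i j) = partial i (b j) x - partial j (b i) x].
Proof.
have [b [sb pb Eb]] := sub_avgs_exact (enum 'I_m).
exists b; split=> // i j x.
by have := congr1 (fun F : V -> R => F x) (Eb i j); rewrite -(avgs_mean x).
Qed.

End Poincare.
End PeriodicForms.

(** * The torus *)

Section FractionalPart.
Context {R : realType}.

Definition frac (x : R) : R := x - (Num.floor x)%:~R.

Lemma frac_bounds x : 0 <= frac x < 1.
Proof. by have /andP[] := floor_itv x; rewrite /frac intrD1; lra. Qed.

Lemma fracDz x (z : int) : frac (x + z%:~R) = frac x.
Proof.
rewrite /frac floorDrz ?intr_int// intrKfloor intrD opprD addrACA.
by rewrite subrr addr0.
Qed.

Lemma frac_id x : 0 <= x < 1 -> frac x = x.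
Proof.
move=> x01; rewrite /frac.
have -> : Num.floor x = 0 by apply/eqP; rewrite floor_eq add0r.
by rewrite subr0.
Qed.

Lemma frac_eq x y : frac x = frac y -> exists z : int, y = x + z%:~R.
Proof.
rewrite /frac => xy; exists (Num.floor y - Num.floor x).
by rewrite intrB; move: xy; lra.
Qed.

End FractionalPart.

(* The carrier is the fundamental domain [0, 1)^m, with the topology making
   [tproj] a quotient map. *)
Definition torus_carrier (R : realType) (m : nat) :=
  {x : 'rV[R]_m | [forall j, 0 <= x 0 j < 1]}.

HB.instance Definition _ (R : realType) m := Choice.on (torus_carrier R m).

Section TorusProjection.
Context {R : realType} {m : nat}.
Notation V := 'rV[R]_m.
Notation T := (torus_carrier R m).

Lemma fracv_subproof (x : V) : [forall j, 0 <= map_mx frac x 0 j < 1].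
Proof. by apply/forallP => j; rewrite mxE frac_bounds. Qed.

Definition tproj (x : V) : T := exist _ (map_mx frac x) (fracv_subproof x).

Lemma tprojK (p : T) : tproj (val p) = p.
Proof.
apply: val_inj; apply/rowP => j; rewrite mxE frac_id//.
by have /forallP := valP p; exact.
Qed.

Lemma tprojD x (z : 'rV[int]_m) : tproj (x + map_mx intr z) = tproj x.
Proof. by apply: val_inj; apply/rowP => j; rewrite !mxE fracDz. Qed.

Lemma tproj_eq x y : tproj x = tproj y ->
  exists z : 'rV[int]_m, y = x + map_mx intr z.
Proof.
move=> /(congr1 val)/rowP xy.
have /choice[z zP] j : exists z : int, y 0 j = x 0 j + z%:~R.
  by apply: frac_eq; have := xy j; rewrite !mxE.
by exists (\row_j z j); apply/rowP => j; rewrite !mxE.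
Qed.

Definition torus_open : set_system T := fun A => open (tproj @^-1` A).

Lemma torus_openT : torus_open setT.
Proof. by rewrite /torus_open preimage_setT; exact: openT. Qed.

Lemma torus_openI : setI_closed torus_open.
Proof.
by move=> A B oA oB; rewrite /torus_open preimage_setI; exact: openI.
Qed.

Lemma torus_open_bigU (I : Type) (f : I -> set T) :
  (forall i, torus_open (f i)) -> torus_open (\bigcup_i f i).
Proof.
move=> of_; rewrite /torus_open preimage_bigcup; apply: bigcup_open => i _.
exact: of_.
Qed.

End TorusProjection.

HB.instance Definition _ (R : realType) m :=
  isOpenTopological.Build (torus_carrier R m)
    torus_openT torus_openI torus_open_bigU.

(** * Topology of the torus *)

Section TorusTopology.
Context {R : realType} {m : nat}.
Notation V := 'rV[R]_m.
Notation T := (torus_carrier R m).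
Implicit Types (x y c : V) (A : set V).

Lemma continuous_tproj : continuous (tproj : V -> T).
Proof. exact/continuousP. Qed.

(** The preimage of the image of [A] is the union of the integer translates of [A]. *)
Lemma open_tproj A : open A -> open (tproj @` A : set T).
Proof.
move=> oA; rewrite /open/= /torus_open.
rewrite [X in open X](_ : _ =
    \bigcup_(z : 'rV[int]_m) [set x | A (x + map_mx intr z)]).
  apply: bigcup_open => z _.
  apply: (@open_comp _ _ (fun x => x + map_mx intr z)).
    by move=> x _; exact: continuous_addr.
  exact: oA.
apply/seteqP; split=> [x [y Ay yx]|x [z _ Axz]].
  have [z yE] := tproj_eq (esym yx); exists z => //=.
  by rewrite -yE.
by exists (x + map_mx intr z) => //; rewrite tprojD.
Qed.

Lemma rV_ballP c x (e : R) : 0 < e ->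
  ball c e x <-> forall j, `|c 0 j - x 0 j| < e.
Proof.
move=> e0; split=> [[_ cx] j|cx]; first exact: cx.
by split=> // i j; rewrite !ord1; exact: cx.
Qed.

Lemma compact_torus : compact [set: T].
Proof.
have -> : [set: T] = tproj @` [set v : V | forall i, v ord0 i \in `[0, 1]].
  apply/esym/seteqP; split=> // p _; exists (val p); last exact: tprojK.
  move=> i; have /forallP/(_ i)/andP[p0 p1] := valP p.
  by rewrite in_itv/= p0 ltW.
apply: continuous_compact.
  exact/continuous_subspaceT/continuous_tproj.
apply: (@rV_compact R m (fun=> `[0, 1]%classic)) => _.
exact: segment_compact.
Qed.

Lemma hausdorff_torus : hausdorff_space T.
Proof.
rewrite open_hausdorff => p q pq.
have [j pqj] : exists j, val p 0 j != val q 0 j.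
  apply/existsP; apply: contraR pq => /existsPn pq; apply/eqP/val_inj/rowP => j.
  by apply/eqP; have := pq j; rewrite negbK.
have /forallP/(_ j)/andP[p0 p1] := valP p.
have /forallP/(_ j)/andP[q0 q1] := valP q.
pose d := `|val p 0 j - val q 0 j|.
have d0 : 0 < d by rewrite normr_gt0 subr_eq0.
have d1 : d < 1 by rewrite /d ltr_norml; lra.
(* The [j]-th coordinates are [d] apart, and at least [1 - d] apart after a nonzero integer shift;
   balls of half the smaller distance have disjoint images. *)
pose e := Num.min d (1 - d) / 2.
have e0 : 0 < e by rewrite divr_gt0// lt_min d0; lra.
have ed : e * 2 <= d by rewrite divfK// ge_min lexx.
have ed1 : e * 2 <= 1 - d by rewrite divfK// ge_min lexx orbT.
have oball (r : T) : open (tproj @` (ball (val r) e : set V)).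
  by apply: open_tproj; exact: ball_open.
have rball (r : T) : (tproj @` (ball (val r) e : set V)) r.
  by exists (val r); [exact: ballxx|exact: tprojK].
exists (tproj @` ball (val p) e, tproj @` ball (val q) e) => /=.
  by rewrite !inE; split; exact: rball.
split; [exact: oball|exact: oball|apply/eqP].
apply/seteqP; split=> // r [/= [x px xr] [y qy yr]].
have [z yE] := tproj_eq (etrans xr (esym yr)).
have : `|val q 0 j - y 0 j| < e by exact: (rV_ballP _ _ e0).1.
have : `|val p 0 j - x 0 j| < e by exact: (rV_ballP _ _ e0).1.
rewrite yE !mxE !ltr_norml => /andP[px1 px2] /andP[qy1 qy2].
have /andP[pq1 pq2] : - d <= val p 0 j - val q 0 j <= d by rewrite -ler_norml.
have dN : d = val p 0 j - val q 0 j \/ d = val q 0 j - val p 0 j.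
  by rewrite /d; case: ger0P => _; [left|right; rewrite opprB].
move: (val p 0 j) (val q 0 j) (x 0 j) d {p0 p1 q0 q1 d1 d0} e e0 ed ed1 px1 px2
  qy1 qy2 pq1 pq2 dN {oball rball px qy yE pqj pq} => P Q X d e e0 ed ed1.
have [z0|z0|z0] := ltgtP (z 0 j) 0.
- have : ((z 0 j)%:~R : R) <= -1 by rewrite -(intrN _ 1) ler_int; lia.
  by move: (_%:~R) => Z Z1 h1 h2 h3 h4 h5 h6 _; move: Z1 h1 h2 h3 h4 h5 h6; lra.
- have : (1 : R) <= (z 0 j)%:~R by rewrite ler1z; lia.
  by move: (_%:~R) => Z Z1 h1 h2 h3 h4 h5 h6 _; move: Z1 h1 h2 h3 h4 h5 h6; lra.
- rewrite z0 mulr0z addr0 => h1 h2 h3 h4 _ _ [] h5;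
    by move: h1 h2 h3 h4 h5; lra.
Qed.

(** The basis consists of the images of balls with rational centres and radii [1 / (n + 1)]. A
    radius below [e / 2], with centre within that radius of [p], keeps the ball inside the given one
    of radius [e]. *)
Lemma second_countable_torus : @second_countable T.
Proof.
pose B (i : 'rV[rat]_m * nat) : set T :=
  tproj @` (ball (map_mx ratr i.1 : V) i.2.+1%:R^-1).
exists (range B); first exact: sub_countable (card_image_le _ _) (countableP _).
split=> [_ [i _ <-]|p U].
  by apply: open_tproj; apply: ball_open; rewrite invr_gt0.
rewrite nbhsE => -[W [oW Wp] WU].
have : nbhs (val p) (tproj @^-1` W).
  by apply: open_nbhs_nbhs; split=> //; rewrite /= tprojK.
move=> /nbhs_ballP[e /= e0 eW].
have e20 : 0 < e / 2 by rewrite divr_gt0.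
have [n _ /(_ n (leqnn n)) /= ne] := near_infty_natSinv_lt (PosNum e20).
set r : R := n.+1%:R^-1 in ne.
have r0 : 0 < r by rewrite invr_gt0.
have /choice[c cP] j :
    exists c : rat, ratr c \in `](val p 0 j), (val p 0 j + r)[.
  by apply: rat_in_itvoo; rewrite ltrDl.
have cp j : `|ratr (c j) - val p 0 j| < r.
  have := cP j; rewrite in_itv/= => /andP[c1 c2].
  by rewrite ltr_norml; lra.
exists (B (\row_j c j, n)); first split.
- by exists (\row_j c j, n).
- exists (val p); last exact: tprojK.
  by apply/rV_ballP => // j; rewrite !mxE; exact: cp.
- move=> _ [y cy <-]; apply/WU/eW/rV_ballP => // j.
  have := (rV_ballP _ _ r0).1 cy j; have := cp j.
  by rewrite !mxE !ltr_norml => /andP[? ?] /andP[? ?]; move: ne => /=; lra.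
Qed.

End TorusTopology.

(** * Charts of the torus *)

Section TorusCharts.
Context {R : realType} {m : nat}.
Notation V := 'rV[R]_m.
Notation T := (torus_carrier R m).
Implicit Types (x y c : V).

(* There is one chart for each point [c] of [R^m], with the open cube of side 1
   centred at [c] as its image, so that transition maps are locally integer
   translations. *)
Definition tdom c : set T := tproj @` ball c 2^-1.

(** The representative of [p] in the half-open unit cube with lower corner [c0], that is, with
    centre [c]. *)
Definition tchart c (p : T) : V :=
  let c0 := c - const_mx 2^-1 in c0 + map_mx frac (val p - c0).

Lemma half_gt0 : 0 < (2^-1 : R). Proof. by rewrite invr_gt0. Qed.

Lemma tchartK c x : ball c 2^-1 x -> tchart c (tproj x) = x.
Proof.
move=> cx; apply/rowP => j; rewrite !mxE.
have := (rV_ballP _ _ half_gt0).1 cx j; rewrite ltr_norml => /andP[cx1 cx2].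
have -> : frac (x 0 j) - (c 0 j - 2^-1) =
    x 0 j - (c 0 j - 2^-1) + (- Num.floor (x 0 j))%:~R.
  by rewrite /frac intrN addrAC.
rewrite fracDz frac_id; first by rewrite addrC subrK.
by move: cx1 cx2; lra.
Qed.

Lemma tchartDz c x (z : 'rV[int]_m) : ball c 2^-1 (x + map_mx intr z) ->
  tchart c (tproj x) = x + map_mx intr z.
Proof. by move=> /tchartK <-; rewrite tprojD. Qed.

Lemma tcodE c : tchart c @` tdom c = ball c 2^-1.
Proof.
apply/seteqP; split=> [_ [_ [x cx <-] <-]|x cx]; first by rewrite tchartK.
by exists (tproj x); [exists x|exact: tchartK].
Qed.

Lemma tdom_open c : open (tdom c).
Proof. by apply: open_tproj; apply: ball_open; exact: half_gt0. Qed.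

Lemma tdom_cover p : exists c, tdom c p.
Proof.
by exists (val p), (val p); [exact/ballxx/half_gt0|exact: tprojK].
Qed.

Lemma tcod_open c : open (tchart c @` tdom c).
Proof. by rewrite tcodE; apply: ball_open; exact: half_gt0. Qed.

Lemma tprojK_dom c p : tdom c p -> tproj (tchart c p) = p.
Proof. by move=> [x cx <-]; rewrite tchartK. Qed.

Lemma tchart_continuous c : {within tdom c, continuous (tchart c)}.
Proof.
rewrite continuous_open_subspace; last exact: tdom_open.
move=> p /set_mem [x cx <-] A; rewrite /= tchartK// nbhsE => -[B [oB Bx] BA].
have oBc : open (B `&` ball c 2^-1).
  by apply: openI => //; apply: ball_open; exact: half_gt0.
apply: (@filterS _ _ _ (tproj @` (B `&` ball c 2^-1))).
  by move=> _ [y [By cy] <-]; rewrite /= tchartK//; exact: BA.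
by apply: open_nbhs_nbhs; split; [exact: open_tproj|exists x].
Qed.

Lemma tproj_within_continuous c :
  {within tchart c @` tdom c, continuous (tproj : V -> T)}.
Proof. exact/continuous_subspaceT/continuous_tproj. Qed.

(** A single integer vector [z] works on a whole neighbourhood of [x], so by [tchartDz] the chart
    composed with [tproj] is there the translation by [z]. *)
Lemma near_tchart c x : tdom c (tproj x) -> exists z : 'rV[int]_m,
  open [set u : V | ball c 2^-1 (u + map_mx intr z)] /\
  ball c 2^-1 (x + map_mx intr z).
Proof.
move=> [y cy yx]; have [z yE] := tproj_eq (esym yx).
exists z; split; last by rewrite -yE.
have oB : open (ball c 2^-1 : set V) by apply: ball_open; exact: half_gt0.
apply: (@open_comp _ _ (fun u : V => u + map_mx intr z)) oB => u _.
exact: continuous_addr.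
Qed.

Lemma smooth_translation (a : V) : smooth (fun x => x + a).
Proof.
apply: (smooth_shift (f := idfun)).
by apply: (@smooth_linear R V V idfun) => x; exact: cvg_id.
Qed.

Lemma ttrans_smooth c c' :
  smooth_on [set x | (tchart c @` tdom c) x /\ tdom c' (tproj x)]
            (tchart c' \o tproj).
Proof.
move=> x [_ /near_tchart[z [oz xz]]].
exists [set u : V | ball c' 2^-1 (u + map_mx intr z)],
  (fun u => u + map_mx intr z).
split=> // [k|u uz _]; last exact: tchartDz.
by apply: CkS (smooth_translation (map_mx intr z) k) => u.
Qed.

Definition torus : manifold R m :=
  Manifold (hausdorff_torus (R := R) (m := m)) second_countable_torus
    tdom_open tdom_cover tcod_open tprojK_dom
    tchart_continuous tproj_within_continuous ttrans_smooth.

Definition chart_at (x : V) : mchart torus := x.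

Lemma torus_mcod_open (c : mchart torus) : open (mcod c).
Proof. exact: tcod_open. Qed.

Lemma mcod_chart_at x : mcod (chart_at x) x.
Proof. by rewrite /mcod [_ @` _]tcodE; exact/ballxx/half_gt0. Qed.

Lemma moverlap_translation (c c' : mchart torus) x : moverlap c c' x ->
  exists2 z : 'rV[int]_m, mtrans c c' x = x + map_mx intr z &
    \forall u \near x, mtrans c c' u = u + map_mx intr z.
Proof.
move=> [_ /near_tchart[z [oz xz]]]; exists z; first exact: tchartDz.
by apply: filterS (open_nbhs_nbhs (conj oz xz)) => u uz; exact: tchartDz.
Qed.

Lemma jacobian_translation (f : V -> V) (a x : V) :
  (\forall u \near x, f u = u + a) -> jacobian f x = 1%:M.
Proof.
move=> fa; have dfE : 'd f x = idfun :> (V -> V).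
  apply: (@diff_unique _ _ _ _ idfun) => [y|]; first exact: cvg_id.
  apply/eqaddoP => e e0; near=> h.
  have -> : (f \o shift x - (cst (f x) + idfun)) h = 0.
    rewrite -[LHS]/(f (h + x) - (f x + h)) (nbhs_singleton fa).
    suff : f (h + x) = h + x + a.
    move=> ->; apply/rowP => j; rewrite !mxE; ring.
    near: h; have : \forall u \near 0 + x, f u = u + a by rewrite add0r.
    exact: (@continuous_addr R V x 0).
  by rewrite normr0 mulr_ge0// ltW.
apply/matrixP => i j; rewrite !mxE dfE mxE eqxx/=.
by rewrite eq_sym.
Unshelve. all: by end_near. Qed.

(** Hence every transformation law on the torus reduces to equality of components, or to commutation
    with the identity. *)
Lemma torus_jacobian (c c' : mchart torus) x : moverlap c c' x ->
  jacobian (mtrans c c') x = 1%:M.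
Proof. by move=> /moverlap_translation[z _]; exact: jacobian_translation. Qed.

(** * Lifts of fields to periodic functions *)

Section Lift.
Context {W : normedModType R}.
Implicit Types (t : mchart torus -> V -> W) (F : V -> W).

(* A tensor field becomes a function on [R^m] by reading its components at [x]
   in the chart centred at [x]. *)
Definition tlift t x : W := t (chart_at x) x.

Definition chart_invariant t := forall (c c' : mchart torus) x,
  moverlap c c' x -> t c x = t c' (mtrans c c' x).

(** The chart centred at a translate of [x] is compared with an arbitrary chart: [z = 0] shows that
    components agree with the lift, general [z] that the lift is periodic. *)
Lemma moverlap_chart_at (z : 'rV[int]_m) (c : mchart torus) x : mcod c x ->
  let c' := chart_at (x + map_mx intr z) in
  moverlap c c' x /\ mtrans c c' x = x + map_mx intr z.
Proof.
move=> cx; have xz : ball (x + map_mx intr z) 2^-1 (x + map_mx intr z).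
  exact/ballxx/half_gt0.
split; last exact: tchartDz.
by split=> //; exists (x + map_mx intr z) => //; exact: tprojD.
Qed.

Lemma liftE t (c : mchart torus) x :
  chart_invariant t -> mcod c x -> t c x = tlift t x.
Proof.
move=> ti cx; have [ov E] := moverlap_chart_at 0 cx.
by rewrite map_mx0 addr0 in ov E; rewrite (ti _ _ _ ov) E.
Qed.

Lemma periodic_lift t : chart_invariant t -> periodic (tlift t).
Proof.
move=> ti x z; have [/ti E xE] := moverlap_chart_at z (mcod_chart_at x).
by rewrite /tlift E xE.
Qed.

Lemma near_lift t (c : mchart torus) x : chart_invariant t -> mcod c x ->
  \forall y \near x, t c y = tlift t y.
Proof.
move=> ti cx; have cxo : open_nbhs x (mcod c).
  by split=> //; exact: torus_mcod_open.
by apply: filterS (open_nbhs_nbhs cxo) => y; exact: liftE.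
Qed.

Lemma smooth_lift t : chart_invariant t ->
  (forall c : mchart torus, smooth_on (mcod c) (t c)) -> smooth (tlift t).
Proof.
move=> ti st; apply: smooth_of_local => x; exists (mcod (chart_at x)).
  by apply: open_nbhs_nbhs; split;
    [exact: torus_mcod_open|exact: mcod_chart_at].
by exists (t (chart_at x)) => // y xy; rewrite (liftE ti xy).
Qed.

Lemma periodic_chart_invariant F : periodic F -> chart_invariant (fun=> F).
Proof.
by move=> pF c c' x /moverlap_translation[z -> _]; rewrite pF.
Qed.

End Lift.
End TorusCharts.

(** * Forms and vector fields on the torus *)

Section TorusForms.
Context {R : realType} {m : nat}.
Notation V := 'rV[R]_m.
Notation X := (@torus R m).
Implicit Types (a : mxfield X) (b : rvfield X) (F : V -> 'M[R]_m).

(** The same components are used in all charts; for periodic [F] this is consistent, transition maps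
    being locally integer translations. *)
Definition global_field W (F : V -> W) : mchart X -> V -> W := fun=> F.

Definition entry a i j : V -> R := fun x => tlift a x i j.

Lemma two_form_invariant a : two_form a -> chart_invariant a.
Proof.
move=> [_ _ ta] c c' x ov; rewrite (ta _ _ _ ov) torus_jacobian//.
by rewrite trmx1 mul1mx mulmx1.
Qed.

Lemma one_form_invariant b : one_form b -> chart_invariant b.
Proof.
move=> [_ tb] c c' x ov; rewrite (tb _ _ _ ov) torus_jacobian//.
by rewrite trmx1 mulmx1.
Qed.

Lemma periodic_two_form F : smooth F -> periodic F ->
  (forall x, (F x)^T = - F x) -> two_form (global_field F).
Proof.
move=> sF pF skF; split=> [c|c x _|c c' x ov]; first exact: smooth_smooth_on.
  exact: skF.
rewrite torus_jacobian// trmx1 mul1mx mulmx1.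
exact: (periodic_chart_invariant pF ov).
Qed.

Lemma periodic_one_form (F : V -> V) : smooth F -> periodic F ->
  one_form (global_field F).
Proof.
move=> sF pF; split=> [c|c c' x ov]; first exact: smooth_smooth_on.
rewrite torus_jacobian// trmx1 mulmx1.
exact: (periodic_chart_invariant pF ov).
Qed.

Section TwoForm.
Context a (ta : two_form a).

Lemma two_form_smooth_lift : smooth (tlift a).
Proof.
by apply: smooth_lift; [exact: two_form_invariant|case: ta].
Qed.

Lemma smooth_entry i j : smooth (entry a i j).
Proof. by have /smooth_mxP := two_form_smooth_lift; exact. Qed.

Lemma two_form_periodic_entry i j : periodic (entry a i j).
Proof.
move=> x z; rewrite /entry periodic_lift//; exact: two_form_invariant.
Qed.

Lemma entry_skew i j : entry a j i = - entry a i j.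
Proof.
apply/funext => x; have [_ ska _] := ta.
have := ska _ _ (mcod_chart_at x) => /matrixP/(_ i j).
by rewrite !mxE.
Qed.

Lemma partial_entry k i j (c : mchart X) x : mcod c x ->
  partial k (fun y => a c y i j) x = partial k (entry a i j) x.
Proof.
move=> cx; apply: near_eq_derive.
by apply: filterS (near_lift (two_form_invariant ta) cx) => y ->.
Qed.

Lemma two_formE c x : mcod c x -> a c x = tlift a x.
Proof. by move=> cx; exact: (liftE (two_form_invariant ta)). Qed.

End TwoForm.

Definition mean_form a : 'M[R]_m := \matrix_(i, j) mean (entry a i j).

Lemma entry_closed a i j k : closed_two_form a ->
  forall x, partial i (entry a j k) x + partial j (entry a k i) x +
    partial k (entry a i j) x = 0.
Proof.
move=> [ta ca] x; have cx := mcod_chart_at x.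
by have := ca _ _ cx i j k; rewrite !(partial_entry ta _ _ _ cx).
Qed.

(** Partial derivatives of periodic functions have mean zero; conversely [sub_mean_exact] supplies a
    periodic primitive once the means vanish. *)
Lemma exact_mean_form a : closed_two_form a ->
  exact_two_form a <-> mean_form a = 0.
Proof.
move=> ca; have [ta _] := ca; split=> [[b ob ab]|m0].
  have bi := one_form_invariant ob.
  have sb : smooth (tlift b) by apply: smooth_lift => //; case: ob.
  pose f i x := tlift b x 0 i.
  have sf i : smooth (f i) by have /smooth_mxP := sb; exact.
  have pf i : periodic (f i) by move=> x z; rewrite /f periodic_lift.
  apply/matrixP => i j; rewrite !mxE.
  have -> : entry a i j = partial i (f j) - partial j (f i).
    apply/funext => x; rewrite /entry /tlift ab ?mxE; last exact: mcod_chart_at.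
    have nb k : \forall y \near x, b (chart_at x) y 0 k = f k y.
      by apply: filterS (near_lift bi (mcod_chart_at x)) => y ->.
    congr (_ - _); apply: near_eq_derive; [exact: nb j|exact: nb i].
  rewrite meanD; last 2 first.
  - exact/smooth_partial.
  - exact/smoothN/smooth_partial.
  rewrite -scaleN1r meanZ; last exact: smooth_partial.
  by rewrite !mean_partial// mulr0 addr0.
have [b [sb pb Eb]] := sub_mean_exact (smooth_entry ta)
  (two_form_periodic_entry ta) (entry_skew ta)
  (fun i j k => funext (entry_closed i j k ca)).
exists (global_field (fun x => \row_i b i x)).
  apply: periodic_one_form.
    apply/smooth_mxP => i j; rewrite [X in smooth X](_ : _ = b j)//.
    by apply/funext => x; rewrite mxE.
  by move=> x z; apply/rowP => j; rewrite !mxE pb.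
move=> c x cx; rewrite (two_formE ta cx); apply/matrixP => i j; rewrite mxE.
have bE k : (fun y => (\row_i b i y) 0 k) = b k.
  by apply/funext => y; rewrite mxE.
rewrite !bE -Eb; move/matrixP/(_ i j) : m0; rewrite !mxE => ->.
by rewrite subr0.
Qed.

Lemma two_formB a a' : two_form a -> two_form a' -> two_form (a' - a).
Proof.
move=> ta ta'; have [_ ska tra] := ta; have [_ ska' tra'] := ta'.
split=> [c|c x cx|c c' x ov].
- have E x : mcod c x -> (a' - a) c x = (tlift a' - tlift a) x.
    by move=> cx; rewrite -[LHS]/(a' c x - a c x) !two_formE.
  move=> x cx; exists (mcod c), (tlift a' - tlift a); split=> //.
  + exact: torus_mcod_open.
  + move=> k; apply: (@CkS _ _ _ _ _ setT) => //.
    by apply: smoothB; exact: two_form_smooth_lift.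
  + by move=> y cy _; exact: E.
- rewrite -[(a' - a) c x]/(a' c x - a c x) linearB/= ska' ?ska//.
  by rewrite opprB opprK addrC.
- rewrite -[LHS]/(a' c x - a c x) (tra _ _ _ ov) (tra' _ _ _ ov).
  by rewrite -mulmxBl -mulmxBr.
Qed.

Lemma entryB a a' i j : entry (a' - a) i j = entry a' i j - entry a i j.
Proof. by apply/funext => x; rewrite /entry /tlift !mxE. Qed.

Lemma closed_two_formB a a' : closed_two_form a -> closed_two_form a' ->
  closed_two_form (a' - a).
Proof.
move=> ca ca'; have [ta _] := ca; have [ta' _] := ca'.
have tB := two_formB ta ta'; split=> // c x cx i j k.
rewrite !(partial_entry tB _ _ _ cx) !entryB.
have dB l p q : partial l (entry a' p q - entry a p q) x =
    partial l (entry a' p q) x - partial l (entry a p q) x.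
  by rewrite partialB//; exact: smooth_entry.
rewrite !dB -[RHS](subrr 0) -{1}(entry_closed i j k ca' x).
by rewrite -(entry_closed i j k ca x); ring.
Qed.

Lemma mean_formB a a' : two_form a -> two_form a' ->
  mean_form (a' - a) = mean_form a' - mean_form a.
Proof.
move=> ta ta'; apply/matrixP => i j; rewrite !mxE entryB -scaleN1r.
have se := smooth_entry ta i j; have se' := smooth_entry ta' i j.
by rewrite (meanD se' (smoothZ _ se)) (meanZ _ se) mulN1r.
Qed.

Lemma deRham_classE a a' : closed_two_form a ->
  deRham_class a a' <-> closed_two_form a' /\ mean_form a' = mean_form a.
Proof.
move=> ca; have [ta _] := ca.
split=> -[ca' H]; split=> //; have [ta' _] := ca'.
  have := (exact_mean_form (closed_two_formB ca ca')).1 H.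
  by rewrite mean_formB// => /subr0_eq.
apply/(exact_mean_form (closed_two_formB ca ca')).
by rewrite mean_formB// H subrr.
Qed.

Lemma eq_deRham_class a a' : closed_two_form a -> closed_two_form a' ->
  deRham_class a = deRham_class a' <-> mean_form a = mean_form a'.
Proof.
move=> ca ca'; split=> [E|E].
  have : deRham_class a a by apply/(deRham_classE a ca).
  by rewrite E => /(deRham_classE _ ca')[].
apply/seteqP; split=> a'' /(deRham_classE _)[]// ca'' E'';
  by apply/deRham_classE => //; split; rewrite // E''.
Qed.

Definition const_form (M : 'M[R]_m) : mxfield X := global_field (cst M).

Lemma entry_const M i j : entry (const_form M) i j = cst (M i j).
Proof. by []. Qed.

Lemma closed_const_form (M : 'M[R]_m) : M^T = - M ->
  closed_two_form (const_form M).
Proof.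
move=> skM; have tM : two_form (const_form M).
  by apply: periodic_two_form => //; exact: smooth_cst.
split=> // c x cx i j k; rewrite !(partial_entry tM _ _ _ cx) !entry_const.
by rewrite !partial_cst !addr0.
Qed.

Lemma mean_const_form M : mean_form (const_form M) = M.
Proof. by apply/matrixP => i j; rewrite mxE entry_const mean_cst. Qed.

(** Reduces the dimension to linear algebra: [M] has to be a basis of the space of mean matrices of
    closed forms satisfying [P]. The constant forms [M i] represent the basis; they need not satisfy
    [P], since only their classes have to contain such a form. *)
Lemma deRham_dim_mean (P : mxfield X -> Prop) k (M : 'I_k -> 'M[R]_m) :
  (forall i, (M i)^T = - M i) ->
  (forall u : 'rV[R]_k, \sum_i u 0 i *: M i = 0 -> u = 0) ->
  (forall u : 'rV[R]_k, exists2 a, closed_two_form a /\ P a &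
     mean_form a = \sum_i u 0 i *: M i) ->
  (forall a, closed_two_form a -> P a -> exists u : 'rV[R]_k,
     mean_form a = \sum_i u 0 i *: M i) ->
  deRham_dim [set deRham_class a | a in [set a | closed_two_form a /\ P a]] k.
Proof.
move=> skM freeM genM meanP; exists (fun i => const_form (M i)).
have sumE (u : 'rV[R]_k) :
    \sum_i u 0 i *: const_form (M i) = const_form (\sum_i u 0 i *: M i).
  elim/big_rec2 : _ => // i M1 f1 _ ->.
  by [].
have skS (u : 'rV[R]_k) : (\sum_i u 0 i *: M i)^T = - \sum_i u 0 i *: M i.
  rewrite linear_sum -sumrN; apply: eq_bigr => i _.
  by rewrite linearZ/= skM scalerN.
have cS u := closed_const_form (skS u).
split=> [i|_ [a [ca Pa] <-]].
  have [a [ca Pa] aE] := genM (delta_mx 0 i); exists a => //.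
  apply/eq_deRham_class => //; first exact: closed_const_form.
  rewrite aE mean_const_form (bigD1 i)//= big1 ?addr0 => [|j ji].
    by rewrite mxE !eqxx scale1r.
  by rewrite mxE (negbTE ji) andbF scale0r.
have [u uE] := meanP a ca Pa; exists u; split.
  by rewrite sumE; apply/eq_deRham_class => //; rewrite mean_const_form.
move=> v; rewrite sumE => /(eq_deRham_class ca (cS v)).
rewrite mean_const_form uE => /eqP; rewrite -subr_eq0 -sumrB => /eqP uv.
apply/subr0_eq/freeM; rewrite -[RHS]uv; apply: eq_bigr => i _.
by rewrite !mxE scalerBl.
Qed.

End TorusForms.

(** * Vector fields and Lie brackets *)

Section VectorFields.
Context {R : realType} {m : nat}.
Notation V := 'rV[R]_m.
Notation X := (@torus R m).
Implicit Types (v w : rvfield X) (F : V -> V).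

Lemma vector_field_invariant v : vector_field v -> chart_invariant v.
Proof.
by move=> [_ tv] c c' x ov; rewrite (tv _ _ _ ov) torus_jacobian// mulmx1.
Qed.

Lemma periodic_vector_field v F : smooth F -> periodic F ->
  (forall c x, mcod c x -> v c x = F x) -> vector_field v.
Proof.
move=> sF pF vF; split=> [c x cx|c c' x ov].
  exists (mcod c), F; split=> // [|k|y cy _]; last exact: vF.
  - exact: torus_mcod_open.
  - exact: (CkS (@subsetT _ _)).
have [cx _] := ov; rewrite torus_jacobian// mulmx1 (vF _ _ cx).
rewrite vF; first exact/esym/(periodic_chart_invariant pF ov).
have [x' c'x' x'E] := ov.2.
by exists (mpsi c x); [exists x'|].
Qed.

Definition bracket F G : V -> V := fun x => 'D_(F x) G x - 'D_(G x) F x.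

Lemma bracketE F G x j : smooth F -> smooth G ->
  bracket F G x 0 j = \sum_k (F x 0 k * partial k (fun y => G y 0 j) x
                             - G x 0 k * partial k (fun y => F y 0 j) x).
Proof.
move=> sF sG; rewrite !mxE !derive_mxE//.
by rewrite !derive_coord ?sumrB//; exact: (smooth_mxP _).1.
Qed.

Lemma smooth_bracket F G : smooth F -> smooth G -> smooth (bracket F G).
Proof.
move=> sF sG; apply/smooth_mxP => i j; rewrite ord1.
have sFj k : smooth (fun x => F x 0 k) by exact: (smooth_mxP _).1.
have sGj k : smooth (fun x => G x 0 k) by exact: (smooth_mxP _).1.
under eq_fun do rewrite bracketE//.
apply: smooth_sum => k; apply: smoothB; apply: smoothM => //;
  exact: smooth_partial.
Qed.

Lemma periodic_derive (W : normedModType R) (f : V -> W) (v : V) :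
  periodic f -> periodic ('D_v f).
Proof.
move=> pf x z; rewrite -derive_comp_shift; congr ('D_v _ x).
by apply/funext => y; exact: pf.
Qed.

Lemma periodic_bracket F G : periodic F -> periodic G -> periodic (bracket F G).
Proof.
move=> pF pG x z; rewrite /bracket pF pG.
by rewrite (periodic_derive _ pG) (periodic_derive _ pF).
Qed.

Lemma lie_bracket_lift v w c x : vector_field v -> vector_field w ->
  mcod c x -> lie_bracket v w c x = bracket (tlift v) (tlift w) x.
Proof.
move=> /vector_field_invariant vi /vector_field_invariant wi cx.
rewrite /lie_bracket /bracket (liftE vi cx) (liftE wi cx).
by rewrite (near_eq_derive _ (near_lift wi cx))
  (near_eq_derive _ (near_lift vi cx)).
Qed.

(** Involutivity of an eigenbundle includes the claim that the bracket is again a smooth field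
    obeying the transformation law. *)
Lemma vector_field_lie_bracket v w : vector_field v -> vector_field w ->
  vector_field (lie_bracket v w).
Proof.
move=> vv vw; have vi := vector_field_invariant vv.
have wi := vector_field_invariant vw.
apply: (@periodic_vector_field _ (bracket (tlift v) (tlift w))).
- by apply: smooth_bracket; apply: smooth_lift => //; [case: vv|case: vw].
- by apply: periodic_bracket; exact: periodic_lift.
- by move=> c x; exact: lie_bracket_lift.
Qed.

End VectorFields.

(** * The structures [K_g] *)

Section Ord4.

Definition c0 : 'I_4 := @Ordinal 4 0 isT.
Definition c1 : 'I_4 := @Ordinal 4 1 isT.
Definition c2 : 'I_4 := @Ordinal 4 2 isT.
Definition c3 : 'I_4 := @Ordinal 4 3 isT.

Lemma ord4_ind (P : 'I_4 -> Prop) :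
  P c0 -> P c1 -> P c2 -> P c3 -> forall i, P i.
Proof.
move=> P0 P1 P2 P3 [[|[|[|[|i]]]] li]; last by [].
- by rewrite (_ : Ordinal li = c0)//; exact: val_inj.
- by rewrite (_ : Ordinal li = c1)//; exact: val_inj.
- by rewrite (_ : Ordinal li = c2)//; exact: val_inj.
- by rewrite (_ : Ordinal li = c3)//; exact: val_inj.
Qed.

Lemma big_ord4 (V : nmodType) (F : 'I_4 -> V) :
  \sum_i F i = F c0 + F c1 + F c2 + F c3.
Proof.
rewrite !big_ord_recr big_ord0/= add0r.
by congr (F _ + F _ + F _ + F _); apply: val_inj.
Qed.

Definition mx_of_rows {R : nzRingType} m n (r : seq (seq R)) : 'M[R]_(m, n) :=
  \matrix_(i, j) nth 0 (nth [::] r i) j.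

End Ord4.

Section ParacomplexMatrix.
Context {R : realType}.

(* The involution with eigenspaces <e0, e2> for 1 and <g e0 + e1, e3> for -1. *)
Definition Kmx (g : R) : 'M[R]_4 := mx_of_rows 4 4
  [:: [:: 1; 0; 0; 0]; [:: - (2 * g); -1; 0; 0]; [:: 0; 0; 1; 0];
      [:: 0; 0; 0; -1]].

Lemma Kmx_sq g : Kmx g *m Kmx g = 1%:M.
Proof.
by apply/matrixP; apply: ord4_ind; apply: ord4_ind;
  rewrite !mxE big_ord4 !mxE /=; ring.
Qed.

(** The rows of [B] lie in the kernel of [A], are independent since [B *m C = 1], and span it: if
    [v *m A = 0], then [v = v *m (C *m B + A *m N) = v *m C *m B]. *)
Lemma rank_kermx (A : 'M[R]_4) (B : 'M[R]_(2, 4)) (C : 'M[R]_(4, 2)) N :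
  B *m A = 0 -> B *m C = 1%:M -> C *m B + A *m N = 1%:M ->
  \rank (kermx A) = 2%N.
Proof.
move=> BA BC CB; have -> : \rank (kermx A) = \rank B.
  apply/eqP; rewrite eqn_leq; apply/andP; split; apply: mxrankS; last first.
    exact/sub_kermxP.
  rewrite -[X in (X <= _)%MS]mulmx1 -CB mulmxDr (mulmxA _ A) mulmx_ker mul0mx.
  by rewrite addr0 mulmxA; exact: submxMl.
by apply/eqP/row_freeP; exists C.
Qed.

(** With [K = Kmx g], the identity is [(1 + K)/2 + (1 - K)/2]: the first projection is factored as
    [C *m B], the second is [A *m N] for [A = K - 1]. The roles are exchanged for the eigenvalue
    -1. *)
Lemma rank_eigenspace_Kmx1 g : \rank (eigenspace (Kmx g) 1) = 2%N.
Proof.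
apply: (@rank_kermx _
  (mx_of_rows 2 4 [:: [:: 1; 0; 0; 0]; [:: 0; 0; 1; 0]])
  (mx_of_rows 4 2 [:: [:: 1; 0]; [:: - g; 0]; [:: 0; 1]; [:: 0; 0]])
  ((- 2^-1)%:M)).
- by apply/matrixP => -[[|[|//]] ?]; apply: ord4_ind;
    rewrite !mxE big_ord4 !mxE /= ?mulr0n ?mulr1n; ring.
- by apply/matrixP => -[[|[|//]] ?] -[[|[|//]] ?];
    rewrite !mxE big_ord4 !mxE /=; ring.
- by apply/matrixP; apply: ord4_ind; apply: ord4_ind;
    rewrite mul_mx_scalar !mxE !big_ord_recl big_ord0 !mxE /= ?mulr0n ?mulr1n;
    field.
Qed.

Lemma rank_eigenspace_KmxN1 g : \rank (eigenspace (Kmx g) (-1)) = 2%N.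
Proof.
apply: (@rank_kermx _
  (mx_of_rows 2 4 [:: [:: g; 1; 0; 0]; [:: 0; 0; 0; 1]])
  (mx_of_rows 4 2 [:: [:: 0; 0]; [:: 1; 0]; [:: 0; 0]; [:: 0; 1]])
  (2^-1%:M)).
- by apply/matrixP => -[[|[|//]] ?]; apply: ord4_ind;
    rewrite !mxE big_ord4 !mxE /= ?mulr0n ?mulr1n; ring.
- by apply/matrixP => -[[|[|//]] ?] -[[|[|//]] ?];
    rewrite !mxE big_ord4 !mxE /=; ring.
- by apply/matrixP; apply: ord4_ind; apply: ord4_ind;
    rewrite mul_mx_scalar !mxE !big_ord_recl big_ord0 !mxE /= ?mulr0n ?mulr1n;
    field.
Qed.

Lemma Kmx_eigen1 g (v : 'rV[R]_4) :
  v *m Kmx g = 1 *: v <-> v 0 c1 = 0 /\ v 0 c3 = 0.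
Proof.
split=> [/rowP E|[v1 v3]].
  by have := E c1; have := E c3; rewrite !mxE !big_ord4 !mxE /=; split; lra.
by apply/rowP; apply: ord4_ind; rewrite !mxE big_ord4 !mxE /= v1 v3; ring.
Qed.

Lemma Kmx_eigenN1 g (v : 'rV[R]_4) :
  v *m Kmx g = -1 *: v <-> v 0 c0 = g * v 0 c1 /\ v 0 c2 = 0.
Proof.
split=> [/rowP E|[v0 v2]].
  by have := E c0; have := E c2; rewrite !mxE !big_ord4 !mxE /=; split; lra.
by apply/rowP; apply: ord4_ind; rewrite !mxE big_ord4 !mxE /= v0 v2; ring.
Qed.

(** The four equations are bundled into one rewrite rule that evaluates both nested sums of
    [Kmx_conjE]. *)
Lemma Kmx_row g (F : 'I_4 -> R) :
  (\sum_k Kmx g c0 k * F k = F c0) *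
  (\sum_k Kmx g c1 k * F k = - (2 * g) * F c0 - F c1) *
  (\sum_k Kmx g c2 k * F k = F c2) * (\sum_k Kmx g c3 k * F k = - F c3).
Proof. by rewrite !big_ord4 !mxE /=; (do !split); ring. Qed.

Lemma Kmx_conjE g (A : 'M[R]_4) i j : (Kmx g *m A *m (Kmx g)^T) i j =
  \sum_k Kmx g i k * \sum_l Kmx g j l * A k l.
Proof.
move: (Kmx g) => M; rewrite mxE; under eq_bigr do rewrite !mxE mulr_suml.
rewrite exchange_big/=; apply: eq_bigr => k _; rewrite mulr_sumr.
by apply: eq_bigr => l _; ring.
Qed.

Lemma skew_eq4 (A B : 'M[R]_4) : A^T = - A -> B^T = - B ->
  A c0 c1 = B c0 c1 -> A c0 c2 = B c0 c2 -> A c0 c3 = B c0 c3 ->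
  A c1 c2 = B c1 c2 -> A c1 c3 = B c1 c3 -> A c2 c3 = B c2 c3 -> A = B.
Proof.
move=> /matrixP skA /matrixP skB AB01 AB02 AB03 AB12 AB13 AB23.
have sA i j : A j i = - A i j by have := skA i j; rewrite !mxE.
have sB i j : B j i = - B i j by have := skB i j; rewrite !mxE.
have dA i : A i i = 0 by have := sA i i; lra.
have dB i : B i i = 0 by have := sB i i; lra.
apply/matrixP; apply: ord4_ind; apply: ord4_ind; rewrite ?dA ?dB//.
- by rewrite (sA c0) (sB c0) AB01.
- by rewrite (sA c0) (sB c0) AB02.
- by rewrite (sA c1) (sB c1) AB12.
- by rewrite (sA c0) (sB c0) AB03.
- by rewrite (sA c1) (sB c1) AB13.
- by rewrite (sA c2) (sB c2) AB23.
Qed.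

(** The index [j] for which the components [(0, j)] and [(1, j)] are tied together by the slope
    [- g]. *)
Definition slope_index (s : bool) : 'I_4 := if s then c3 else c2.

(** The part of the type condition that does not involve [g]; being linear with constant
    coefficients, it passes to the means. *)
Definition type_zeros (s : bool) (A : 'M[R]_4) : Prop :=
  if s then A c0 c2 = 0 else [/\ A c0 c1 = 0, A c0 c3 = 0 & A c2 c3 = 0].

Definition Kmx_type g (s : bool) (A : 'M[R]_4) : Prop :=
  type_zeros s A /\ A c1 (slope_index s) = - g * A c0 (slope_index s).

Lemma Kmx_typeP g (A : 'M[R]_4) (s : bool) : A^T = - A ->
  Kmx g *m A *m (Kmx g)^T = (-1) ^+ s *: A <-> Kmx_type g s A.
Proof.
move=> skA; have /matrixP skAE := skA.
have sk i j : A j i = - A i j by have := skAE i j; rewrite !mxE.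
have dg i : A i i = 0 by have := sk i i; lra.
have E i j := Kmx_conjE g A i j.
split=> [/matrixP|] H.
  have := H c0 c1; have := H c0 c3; have := H c2 c3.
  have := H c1 c2; have := H c0 c2; have := H c1 c3.
  rewrite !E !Kmx_row !mxE dg /Kmx_type /type_zeros /slope_index.
  by case: (s); rewrite ?expr1 ?expr0 => *; split; try split; lra.
apply: skew_eq4.
- by rewrite !trmx_mul trmxK skA mulNmx mulmxN mulmxA.
- by rewrite linearZ/= skA scalerN.
all: rewrite E !Kmx_row !mxE; move: H.
all: rewrite /Kmx_type /type_zeros /slope_index.
all: by case: (s) => [[h02 h13]|[[h01 h03 h23] h12]];
  rewrite ?dg ?expr1 ?expr0 ?h12 ?h13 ?h01 ?h02 ?h03 ?h23; ring.
Qed.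

End ParacomplexMatrix.

(** * The twisted structures on the 4-torus *)

Section TwistedFamily.
Context {R : realType}.
Notation V := 'rV[R]_4.
Notation X := (@torus R 4).

(** Squaring gives period 1 and nonnegativity; the zeros are the integers. *)
Definition sin2 (u : R) : R := sin (pi * u) ^+ 2.

Lemma sin2Dz u (z : int) : sin2 (u + z%:~R) = sin2 u.
Proof.
have sin2D1 t : sin2 (t + 1) = sin2 t.
  by rewrite /sin2 mulrDr mulr1 sinDpi sqrrN.
have sin2Dn n t : sin2 (t + n%:R) = sin2 t.
  by elim: n => [|n IHn]; rewrite ?addr0// -natr1 addrA sin2D1.
case: z => n; first exact: sin2Dn.
by rewrite -(sin2Dn n.+1) NegzE intrN addrNK.
Qed.

Lemma sin2_0 : sin2 0 = 0.
Proof. by rewrite /sin2 mulr0 sin0 expr0n. Qed.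

Lemma sin2_ge0 u : 0 <= sin2 u.
Proof. exact: sqr_ge0. Qed.

Lemma sin2_gt0 u : 0 < u < 1 -> 0 < sin2 u.
Proof.
move=> /andP[u0 u1]; rewrite exprn_gt0// sin_gt0_pi//.
by rewrite mulr_gt0 ?pi_gt0//= -[ltRHS]mulr1 ltr_pM2l// pi_gt0.
Qed.

Lemma smooth_sin2 : smooth sin2.
Proof.
have s : smooth (fun u : R => sin (pi * u)).
  apply: (@smooth_affine R _ _ _ (fun u : R => pi * u) (fun u => pi * u) _ sin).
  - by move=> h v x; rewrite mulrDr scalerAr.
  - by move=> u; apply: cvgM; [exact: cvg_cst|exact: cvg_id].
  - exact: smooth_sin.
rewrite (_ : sin2 = (fun u => sin (pi * u)) * (fun u => sin (pi * u))).
  exact: smoothM.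
by apply/funext => u; rewrite /sin2 expr2.
Qed.


Lemma Kmx_affine (g : R) i j :
  Kmx g i j = Kmx 0 i j + (Kmx 1 i j - Kmx 0 i j) * g.
Proof.
by move: i j; apply: ord4_ind; apply: ord4_ind; rewrite !mxE /=; ring.
Qed.

Lemma smooth_Kmx (W : normedModType R) (g : W -> R) :
  smooth g -> smooth (fun z => Kmx (g z)).
Proof.
move=> sg; apply/smooth_mxP => i j; under eq_fun do rewrite Kmx_affine.
have sc (c : R) : smooth (cst c : W -> R) by exact: smooth_cst.
exact: (smoothD (sc _) (smoothM (sc _) sg)).
Qed.

Definition Kfield (g : V -> R) : mxfield X := global_field (fun x => Kmx (g x)).

Section Foliation.
Context (g : V -> R).
Hypotheses (sg : smooth g) (pg : periodic g)
  (g0 : forall x y : V, x 0 c0 = y 0 c0 -> g x = g y).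

Lemma partial_g k x : k != c0 -> partial k g x = 0.
Proof.
move=> k0; rewrite /partial /derive; under eq_fun => h.
  rewrite /= (g0 (y := x)); last first.
    by rewrite !mxE eqxx eq_sym (negbTE k0) mulr0 add0r.
  rewrite subrr scaler0; over.
exact: lim_cst.
Qed.

Lemma smooth_Kfield : smooth (fun x => Kmx (g x)).
Proof. exact: smooth_Kmx. Qed.

Lemma almost_D_complex_Kfield : @almost_D_complex R 2 X (Kfield g).
Proof.
have pK : periodic (fun x => Kmx (g x)) by move=> x z; rewrite pg.
split; first split=> [c|c c' x ov].
    by apply: smooth_smooth_on; exact: smooth_Kfield.
  rewrite torus_jacobian// mulmx1 mul1mx.
  exact: (periodic_chart_invariant pK ov).
move=> c x _; split; first exact: Kmx_sq.
  exact: rank_eigenspace_Kmx1.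
exact: rank_eigenspace_KmxN1.
Qed.

Lemma eigen_section_lift (l : R) v : vector_field v ->
  eigen_section (Kfield g) l v <->
  forall x, tlift v x *m Kmx (g x) = l *: tlift v x.
Proof.
move=> vv; split=> [[_ H] x|H]; first exact/H/mcod_chart_at.
by split=> // c x cx; rewrite (liftE (vector_field_invariant vv) cx) H.
Qed.

(** Passing to lifts turns involutivity into a computation with vector fields on [R^4]. *)
Lemma involutive_Kfield (l : R) :
  (forall F G : V -> V, smooth F -> smooth G ->
    (forall x, F x *m Kmx (g x) = l *: F x) ->
    (forall x, G x *m Kmx (g x) = l *: G x) ->
    forall x, bracket F G x *m Kmx (g x) = l *: bracket F G x) ->
  involutive_eigenbundle (Kfield g) l.
Proof.
move=> H v w ev ew; have [vv _] := ev; have [vw _] := ew.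
apply/eigen_section_lift; first exact: vector_field_lie_bracket.
move=> x; rewrite {1 2}/tlift lie_bracket_lift//; last exact: mcod_chart_at.
apply: H.
- by apply: smooth_lift; [exact: vector_field_invariant|case: vv].
- by apply: smooth_lift; [exact: vector_field_invariant|case: vw].
- exact/eigen_section_lift.
- exact/eigen_section_lift.
Qed.

(** The eigenbundle is the coordinate plane field where components 1 and 3 vanish identically, and
    the bracket formula preserves this. *)
Lemma involutive1 : involutive_eigenbundle (Kfield g) 1.
Proof.
apply: involutive_Kfield => F G sF sG eF eG x.
have F0 j : j = c1 \/ j = c3 -> (fun y => F y 0 j) = cst 0.
  by move=> jE; apply/funext => y; have [? ?] := (Kmx_eigen1 _ _).1 (eF y);
    case: jE => ->.
have G0 j : j = c1 \/ j = c3 -> (fun y => G y 0 j) = cst 0.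
  by move=> jE; apply/funext => y; have [? ?] := (Kmx_eigen1 _ _).1 (eG y);
    case: jE => ->.
have B0 j : j = c1 \/ j = c3 -> bracket F G x 0 j = 0.
  move=> jE; rewrite bracketE// F0// G0// big1// => k _.
  by rewrite partial_cst !mulr0 subr0.
by apply/Kmx_eigen1; split; apply: B0; [left|right].
Qed.

(** For sections with [F_0 = g F_1] and [G_0 = g G_1], the Leibniz rule gives [[F, G]_0 - g [F, G]_1
    = G_1 F(g) - F_1 G(g)]. As [g] depends on [x0] only, [F(g) = g F_1 d_0 g] and likewise for [G],
    so the difference cancels. *)
Lemma involutiveN1 : involutive_eigenbundle (Kfield g) (-1).
Proof.
apply: involutive_Kfield => F G sF sG eF eG x.
have sF1 : smooth (fun y => F y 0 c1) by exact: (smooth_mxP _).1.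
have sG1 : smooth (fun y => G y 0 c1) by exact: (smooth_mxP _).1.
have e0 (H : V -> V) : (forall y, H y *m Kmx (g y) = -1 *: H y) ->
    (fun y => H y 0 c0) = g * (fun y => H y 0 c1).
  by move=> eH; apply/funext => y; case: ((Kmx_eigenN1 _ _).1 (eH y)).
have e2 (H : V -> V) : (forall y, H y *m Kmx (g y) = -1 *: H y) ->
    (fun y => H y 0 c2) = cst 0.
  by move=> eH; apply/funext => y; case: ((Kmx_eigenN1 _ _).1 (eH y)).
have dg k (h : V -> R) : smooth h -> partial k (g * h) x =
    g x * partial k h x + h x * partial k g x.
  by move=> sh; rewrite /partial deriveM//; exact: smooth_derivable.
apply/Kmx_eigenN1; split; rewrite !bracketE//.
  rewrite !(e0 F)// !(e0 G)//.
  have [F0 _] := (Kmx_eigenN1 _ _).1 (eF x).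
  have [G0 _] := (Kmx_eigenN1 _ _).1 (eG x).
  have sumg (H : V -> V) :
      \sum_k H x 0 k * partial k g x = H x 0 c0 * partial c0 g x.
    by rewrite (bigD1 c0)//= big1 ?addr0// => k k0; rewrite partial_g// mulr0.
  have split_term k :
      F x 0 k * partial k (g * (fun y => G y 0 c1)) x
        - G x 0 k * partial k (g * (fun y => F y 0 c1)) x =
      g x * (F x 0 k * partial k (fun y => G y 0 c1) x
             - G x 0 k * partial k (fun y => F y 0 c1) x) +
      (G x 0 c1 * (F x 0 k * partial k g x)
       - F x 0 c1 * (G x 0 k * partial k g x)).
    rewrite !dg//; move: (partial k g x) (partial k (fun y => G y 0 c1) x).
    by move: (partial k (fun y => F y 0 c1) x) => p q r; ring.
  under eq_bigr do rewrite split_term.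
  rewrite big_split/= [X in _ + X]sumrB -!mulr_sumr !sumg F0 G0.
  by move: (partial c0 g x) (\sum_i _) => p S; ring.
rewrite !(e2 F)// !(e2 G)// big1// => k _.
by rewrite partial_cst !mulr0 subr0.
Qed.

Lemma D_complex_Kfield : @D_complex R 2 X (Kfield g).
Proof.
split; [exact: almost_D_complex_Kfield|exact: involutive1|exact: involutiveN1].
Qed.

End Foliation.

Definition twist (a b : R) (x : V) : R := a + b * sin2 (x 0 c0).

Lemma periodic_twist a b : periodic (twist a b).
Proof. by move=> x z; rewrite /twist !mxE sin2Dz. Qed.

Lemma eq_twist a b (x y : V) : x 0 c0 = y 0 c0 -> twist a b x = twist a b y.
Proof. by rewrite /twist => ->. Qed.

Lemma smooth_twist a b : smooth (twist a b).
Proof.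
have su (f : R -> R) : smooth f -> smooth (fun x : V => f (x 0 c0)).
  move=> sf; apply: (@smooth_affine R V _ _ (fun x => x 0 c0)
    (fun x => x 0 c0) _ f) => // [h v x|]; first by rewrite !mxE.
  exact: coord_continuous.
apply: (smoothD (f := cst a)); first exact: smooth_cst.
apply: (smoothM (f := cst b)); first exact: smooth_cst.
exact: su smooth_sin2.
Qed.

(** The components are jointly smooth on all of [R * R^4], so every parameter set [I] is allowed. *)
Lemma D_complex_curve_twist (I : set R) (a b : R -> R) : smooth a -> smooth b ->
  @D_complex_curve R 2 X I (fun t => Kfield (twist (a t) (b t))).
Proof.
move=> sa sb; split=> [t _|c].
  apply: D_complex_Kfield;
    [exact: smooth_twist|exact: periodic_twist|exact: eq_twist].
apply: smooth_smooth_on.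
apply: (@smooth_Kmx _ (fun z : R * V => a z.1 + b z.1 * sin2 (z.2 0 c0))).
have s1 (f : R -> R) : smooth f -> smooth (fun z : R * V => f z.1).
  move=> sf; apply: (@smooth_affine R (R * V)%type _ _ fst fst _ f) => //.
  by move=> z; exact: cvg_fst.
apply: (smoothD (s1 _ sa)); apply: (smoothM (s1 _ sb)).
apply: (@smooth_affine R (R * V)%type _ _ (fun z => z.2 0 c0)
  (fun z => z.2 0 c0) _ sin2) => [h v x|z|]; first by rewrite !mxE.
  apply: (@continuous_comp _ _ _ snd (fun x : V => x 0 c0)).
    exact: cvg_snd.
  exact: coord_continuous.
exact: smooth_sin2.
Qed.

End TwistedFamily.

(** * Bases of constant 2-forms of a given type *)

Section WedgeMatrices.
Context {R : realType}.

(** The matrix of [dx_i /\ dx_j]. *)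
Definition wedge_mx (i j : 'I_4) : 'M[R]_4 := \matrix_(k, l)
  ((k == i)%:R * (l == j)%:R - (k == j)%:R * (l == i)%:R).

Lemma tr_wedge_mx i j : (wedge_mx i j)^T = - wedge_mx i j.
Proof. by apply/matrixP => k l; rewrite !mxE; ring. Qed.

Lemma ord4_neq : ((c0 == c1) = false) * ((c0 == c2) = false) *
  ((c0 == c3) = false) * ((c1 == c0) = false) * ((c1 == c2) = false) *
  ((c1 == c3) = false) * ((c2 == c0) = false) * ((c2 == c1) = false) *
  ((c2 == c3) = false) * ((c3 == c0) = false) * ((c3 == c1) = false) *
  ((c3 == c2) = false).
Proof. by []. Qed.

(* Together with the components of index (0, j) and (1, j), where
   [j = slope_index s], these span the skew matrices of type [s]. *)
Definition free_mx (s : bool) : seq 'M[R]_4 :=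
  if s then [:: wedge_mx c0 c1; wedge_mx c1 c2; wedge_mx c2 c3]
  else [:: wedge_mx c1 c3].

Definition free_dim (s : bool) : nat := if s then 3 else 1.

Definition free_comb (s : bool) (w : 'I_(free_dim s) -> R) : 'M[R]_4 :=
  \sum_i w i *: (free_mx s)`_i.

(** The matrix of [(p dx_0 + q dx_1) /\ dx_j] with [j = slope_index s]. *)
Definition slope_mx (s : bool) (p q : R) : 'M[R]_4 :=
  p *: wedge_mx c0 (slope_index s) + q *: wedge_mx c1 (slope_index s).

Lemma tr_free_mx s i : ((free_mx s)`_i)^T = - (free_mx s)`_i.
Proof.
case: s i => [[|[|[|i]]]|[|i]]; rewrite /= ?tr_wedge_mx//;
by rewrite nth_nil trmx0 oppr0.
Qed.

Lemma tr_free_comb s w : (@free_comb s w)^T = - free_comb w.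
Proof.
rewrite /free_comb linear_sum -sumrN; apply: eq_bigr => i _.
by rewrite linearZ/= tr_free_mx scalerN.
Qed.

Lemma tr_slope_mx s p q : (slope_mx s p q)^T = - slope_mx s p q.
Proof.
by rewrite /slope_mx linearD/= !linearZ/= !tr_wedge_mx !scalerN opprD.
Qed.

Lemma slope_free_type s (p q g : R) w : q = - g * p ->
  Kmx_type g s (slope_mx s p q + @free_comb s w).
Proof.
move=> ->; case: s w => w; rewrite /Kmx_type /type_zeros /slope_mx /free_comb;
rewrite !big_ord_recl big_ord0 /= !mxE ?eqxx ?ord4_neq /=;
split; try split; ring.
Qed.

(** The slope part and the free part occupy disjoint sets of entries above the diagonal. *)
Lemma slope_free_inj s (p q : R) w :
  slope_mx s p q + @free_comb s w = 0 -> [/\ p = 0, q = 0 & forall i, w i = 0].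
Proof.
case: s w => w;
  rewrite /slope_mx /free_comb !big_ord_recl big_ord0 /= => /matrixP H.
  have H03 := H c0 c3; have H13 := H c1 c3; have H01 := H c0 c1.
  have H12 := H c1 c2; have H23 := H c2 c3.
  move: H03 H13 H01 H12 H23; rewrite !mxE ?eqxx ?ord4_neq /= => *.
  split; [lra|lra|].
  by move=> -[[|[|[|//]]] li];
    [have -> : Ordinal li = ord0 by exact: val_inj
    |have -> : Ordinal li = lift ord0 ord0 by exact: val_inj
    |have -> : Ordinal li = lift ord0 (lift ord0 ord0) by exact: val_inj]; lra.
have H02 := H c0 c2; have H12 := H c1 c2; have H13 := H c1 c3.
move: H02 H12 H13; rewrite !mxE ?eqxx ?ord4_neq /= => *.
split; [lra|lra|] => i; rewrite (ord1 i); lra.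
Qed.

Lemma slope_freeP s (A : 'M[R]_4) : A^T = - A -> type_zeros s A ->
  exists w, A = slope_mx s (A c0 (slope_index s)) (A c1 (slope_index s)) +
    @free_comb s w.
Proof.
have skS p q w : (slope_mx s p q + @free_comb s w)^T =
    - (slope_mx s p q + free_comb w).
  by rewrite linearD/= tr_slope_mx tr_free_comb [RHS]opprD.
move=> skA; case: s skS => skS zA.
  exists (fun i : 'I_(free_dim true) => [:: A c0 c1; A c1 c2; A c2 c3]`_i).
  by apply: skew_eq4 => //; move: zA;
    rewrite /type_zeros /slope_mx /free_comb /slope_index /free_dim/=;
    rewrite !big_ord_recl big_ord0 /= !mxE ?eqxx ?ord4_neq /=; lra.
exists (fun=> A c1 c3).
by apply: skew_eq4 => //; move: zA;
  rewrite /type_zeros /slope_mx /free_comb /slope_index /free_dim/=;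
  rewrite !big_ord_recl big_ord0 /= !mxE ?eqxx ?ord4_neq /= => -[]; lra.
Qed.

End WedgeMatrices.

(** * Dimension of the spaces of classes *)

Section FirstCoordinate.
Context {R : realType}.
Notation V := 'rV[R]_4.
Notation X := (@torus R 4).

Definition depends_on_c0 (h : V -> R) := 
  forall x y : V, x 0 c0 = y 0 c0 -> h x = h y.

Definition fiber_avg (f : V -> R) : V -> R := avgs [:: c1; c2; c3] f.

Lemma enum_ord4 : enum 'I_4 = [:: c0; c1; c2; c3].
Proof. by apply: (inj_map val_inj); rewrite val_enum_ord. Qed.

Lemma mean_fiber_avg f : mean f = avg (delta_mx 0 c0) (fiber_avg f) 0.
Proof. by rewrite /mean enum_ord4. Qed.

(** [h] is constant along the segment of integration. *)
Lemma avgM_indep h f k : depends_on_c0 h -> smooth f -> k != c0 ->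
  avg (delta_mx 0 k) (h * f) = h * avg (delta_mx 0 k) f.
Proof.
move=> h0 sf k0; apply/funext => x.
rewrite -[RHS]/(h x * _) /avg /wavg -itgZ; last first.
  apply: (@continuous_wline _ _ (cst 1) f); first by move=> r; exact: cvg_cst.
  exact: smooth_continuous.
apply: eq_itg => r _; rewrite /cst !mul1r; congr (_ * _); apply: h0.
by rewrite !mxE eqxx eq_sym (negbTE k0) mulr0 add0r.
Qed.

Lemma fiber_avgM h f : depends_on_c0 h -> smooth f ->
  fiber_avg (h * f) = h * fiber_avg f.
Proof.
move=> h0 sf; rewrite /fiber_avg/=.
rewrite (avgM_indep h0 sf)// (avgM_indep h0)//; last exact: smooth_avg.
by rewrite (avgM_indep h0)//; do 2 apply: smooth_avg.
Qed.

Lemma fiber_avg_indep h : depends_on_c0 h -> fiber_avg h = h.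
Proof.
move=> h0; have /(fiber_avgM h0) : smooth (cst 1 : V -> R) by exact: smooth_cst.
rewrite /fiber_avg avgs_cst; have -> // : h * cst 1 = h.
by apply/funext => x; exact: mulr1.
Qed.

Lemma mean_indep h : depends_on_c0 h -> mean h = avg (delta_mx 0 c0) h 0.
Proof. by move=> h0; rewrite mean_fiber_avg fiber_avg_indep. Qed.

(** Derivatives of the fibre average in directions 1, 2, 3 vanish by periodicity. In direction 0,
    closedness gives [d_0 a_1j = - (d_1 a_j0 + d_j a_01)], whose fibre average vanishes for the same
    reason. *)
Lemma fiber_avg_closed (a : mxfield X) j : closed_two_form a ->
  j \in [:: c2; c3] ->
  forall x, fiber_avg (entry a c1 j) x = mean (entry a c1 j).
Proof.
move=> ca jE; have [ta _] := ca; have sa := smooth_entry ta.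
have pa := two_form_periodic_entry ta.
have jB : j \in [:: c1; c2; c3] by rewrite in_cons jE orbT.
have B0 : forall k x, partial k (fiber_avg (entry a c1 j)) x = 0.
  move=> k x.
  have [kB|] := boolP (k \in [:: c1; c2; c3]).
    by rewrite /fiber_avg partial_avgs0.
  have [->|k0 kB] := eqVneq k c0; last first.
    by move: k k0 kB; apply: ord4_ind.
  rewrite /fiber_avg partial_avgs//.
  have -> : partial c0 (entry a c1 j) =
      (-1) *: (partial c1 (entry a j c0) + partial j (entry a c0 c1)).
    apply/funext => y; have := entry_closed c0 c1 j ca y.
    rewrite -addrA => /eqP; rewrite addr_eq0 => /eqP ->.
    by rewrite -[RHS]/(-1 * (_ + _)) mulN1r.
  have sd k' i l : smooth (partial k' (entry a i l)) by exact: smooth_partial.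
  rewrite avgsZ; last exact: smoothD.
  rewrite avgsD// -!partial_avgs// !partial_avgs0//.
  by rewrite -[LHS]/(-1 * (0 + 0)) addr0 mulr0.
have sB : smooth (fiber_avg (entry a c1 j)) by exact: smooth_avgs.
move=> x; rewrite (partial0_cst sB B0) mean_fiber_avg.
rewrite [in RHS](_ : fiber_avg (entry a c1 j) =
  cst (fiber_avg (entry a c1 j) 0)).
  by rewrite avg_cst.
by apply/funext => y; exact: (partial0_cst sB B0).
Qed.

End FirstCoordinate.

(** * Dimension for a structure twisted by a function of the first coordinate *)

Section Dimensions.
Context {R : realType} (g : 'rV[R]_4 -> R) (s : bool).
Notation V := 'rV[R]_4.
Notation X := (@torus R 4).
Notation j := (slope_index s).
Hypothesis g0 : depends_on_c0 g.

Definition typed (a : mxfield X) := forall c x, mcod c x ->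
  endo_act (Kfield g) a c x = (-1) ^+ s *: a c x.

Lemma typedP a : two_form a ->
  typed a <-> forall x, Kmx_type (g x) s (tlift a x).
Proof.
move=> ta; have [_ ska _] := ta.
have skl x : (tlift a x)^T = - tlift a x by apply: ska; exact: mcod_chart_at.
split=> [H x|H c x cx].
  by apply/Kmx_typeP => //; exact/H/mcod_chart_at.
by rewrite /endo_act (two_formE ta cx); apply/Kmx_typeP.
Qed.

(** The slope relation is averaged over the fibres only: [g] can be pulled out as a function of
    [x0], and the left-hand side is already constant by [fiber_avg_closed]. *)
Lemma typed_mean a : closed_two_form a -> typed a ->
  type_zeros s (mean_form a) /\
  forall x, mean_form a c1 j = - g x * fiber_avg (entry a c0 j) x.
Proof.
move=> ca tya; have [ta _] := ca; have H := (typedP ta).1 tya.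
have zE i k : (forall x, tlift a x i k = 0) -> mean_form a i k = 0.
  move=> ik0; rewrite mxE (_ : entry a i k = cst 0) ?mean_cst//.
  by apply/funext => x; exact: ik0.
split.
  move: H; rewrite /Kmx_type /type_zeros; case: (s) => H.
    by apply: zE => x; case: (H x).
  by split; apply: zE => x; case: (H x) => -[].
have jE : j \in [:: c2; c3] by rewrite /slope_index; case: (s).
move=> x; rewrite mxE -(fiber_avg_closed ca jE x).
have -> : entry a c1 j = - g * entry a c0 j.
  by apply/funext => y; case: (H y).
rewrite fiber_avgM => [||]; first by [].
  by move=> y y' yy'; rewrite -[LHS]/(- g y) (g0 yy').
exact: smooth_entry.
Qed.

Lemma tr_slope_free p q w : (slope_mx s p q + @free_comb R s w)^T =
  - (slope_mx s p q + free_comb w).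
Proof. by rewrite linearD/= tr_slope_mx tr_free_comb [RHS]opprD. Qed.

(** Only the free part of the mean survives, and every free combination is realised by a constant
    form, for which the slope relation reads [0 = - g 0]. *)
Lemma deRham_dim_free :
  (forall a, closed_two_form a -> typed a ->
     mean_form a c0 j = 0 /\ mean_form a c1 j = 0) ->
  deRham_dim (H2pm (Kfield g) s) (free_dim s).
Proof.
move=> H.
have s00 (A : 'M[R]_4) : slope_mx s 0 0 + A = A.
  by rewrite /slope_mx !scale0r !add0r.
apply: (@deRham_dim_mean R 4 typed _ (fun i => (free_mx s)`_i)).
- by move=> i; exact: tr_free_mx.
- move=> u u0; apply/rowP => i; rewrite mxE.
  have := @slope_free_inj R s 0 0 (fun i => u 0 i).
  by rewrite s00 => /(_ u0)[_ _]; exact.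
- move=> u; set A := \sum_i _; have skA : A^T = - A by exact: tr_free_comb.
  have cA := closed_const_form skA.
  exists (const_form A); last exact: mean_const_form.
  split=> //; apply/typedP => [|x]; first by case: cA.
  rewrite -[tlift _ _]s00; apply: slope_free_type.
  by rewrite mulr0.
- move=> a ca tya; have [z _] := typed_mean ca tya.
  have [ta _] := ca; have [m0 m1] := H a ca tya.
  have skm : (mean_form a)^T = - mean_form a.
    apply/matrixP => i k; rewrite !mxE (entry_skew ta) -scaleN1r.
    by rewrite (meanZ _ (smooth_entry ta i k)) mulN1r.
  have [w wE] := slope_freeP skm z; exists (\row_i w i).
  rewrite {1}wE m0 m1 s00; apply: eq_bigr => i _; by rewrite mxE.
Qed.

Section Slope.
(** Common setting for two cases: [phi = 1, mu = 0] when [g = 0], and [phi = 1/g, mu = 1] when [g]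
    is positive. The additional class is that of [(phi dx_0 - mu dx_1) /\ dx_j]. *)
Context (phi : V -> R) (mu : R).
Hypotheses (sphi : smooth phi) (pphi : periodic phi)
  (phi0 : depends_on_c0 phi) (phig : forall x, phi x * g x = mu)
  (phimu : mean phi = 0 -> mu = 0 -> False)
  (slope_closed : forall a, closed_two_form a -> typed a -> exists t,
     mean_form a c0 j = t * mean phi /\ mean_form a c1 j = - t * mu).

Definition slope_form t w : mxfield X := global_field (fun x : V =>
  slope_mx s (t * phi x) (- t * mu) + @free_comb R s w).

Lemma entry_slope_form t w i k : entry (slope_form t w) i k =
  (t * wedge_mx c0 j i k) *: phi +
  cst ((slope_mx s 0 (- t * mu) + free_comb w) i k).
Proof.
apply/funext => x.
rewrite -[RHS]/(t * wedge_mx c0 j i k * phi x + _ i k).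
rewrite /entry /tlift /slope_form /global_field /slope_mx.
by move: (free_comb w) => A; rewrite !mxE; ring.
Qed.

Lemma smooth_slope_entry t w i k : smooth (entry (slope_form t w) i k).
Proof.
rewrite entry_slope_form; apply: smoothD; first exact: smoothZ.
exact: smooth_cst.
Qed.

(** Since [phi] depends on [x0] only, [phi dx_0] is closed, and the remaining coefficients are
    constant. *)
Lemma closed_slope_form t w : closed_two_form (slope_form t w).
Proof.
have tF : two_form (slope_form t w).
  apply: periodic_two_form.
  - by apply/smooth_mxP => i k; exact: smooth_slope_entry.
  - by move=> x z; rewrite pphi.
  - by move=> x; exact: tr_slope_free.
split=> // c x cx i k l; rewrite !(partial_entry tF _ _ _ cx).
have dE q : partial q phi x = (q == c0)%:R * partial c0 phi x.
  by have [->|q0] := eqVneq q c0; rewrite ?mul1r// mul0r partial_g.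
have dF p q r : partial p (entry (slope_form t w) q r) x =
    t * wedge_mx c0 j q r * ((p == c0)%:R * partial c0 phi x).
  rewrite entry_slope_form partialD; last 2 first.
  - exact: smoothZ.
  - exact: smooth_cst.
  by rewrite partialZ// partial_cst addr0 -dE.
rewrite !dF !mxE; move: (partial c0 phi x) => d; ring.
Qed.

Lemma mean_slope_form t w : mean_form (slope_form t w) =
  slope_mx s (t * mean phi) (- t * mu) + free_comb w.
Proof.
apply/matrixP => i k; rewrite mxE entry_slope_form meanD; last 2 first.
- exact: smoothZ.
- exact: smooth_cst.
rewrite meanZ// mean_cst /slope_mx; move: (free_comb w) => A.
rewrite !mxE; ring.
Qed.

Lemma typed_slope_form t w : typed (slope_form t w).
Proof.
apply/typedP => [|x]; first by case: (closed_slope_form t w).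
by apply: slope_free_type; rewrite -(phig x); ring.
Qed.

(** The extra generator [L] is the mean of [slope_form] for [t = 1] without free part. It is nonzero
    by [phimu], and by [slope_closed] the slope part of any mean is a multiple of it. *)
Lemma deRham_dim_slope : deRham_dim (H2pm (Kfield g) s) (free_dim s).+1.
Proof.
pose L := slope_mx s (mean phi) (- mu).
have sumE (u : 'rV[R]_(free_dim s).+1) :
    \sum_i u 0 i *: (L :: free_mx s)`_i =
    slope_mx s (u 0 0 * mean phi) (- u 0 0 * mu) +
    free_comb (fun i => u 0 (lift 0 i)).
  rewrite big_ord_recl; congr (_ + _).
  by rewrite /L /slope_mx /= scalerDr !scalerA mulrN mulNr.
apply: (@deRham_dim_mean R 4 typed _ (fun i => (L :: free_mx s)`_i)).
- by case=> -[|i] ?; [exact: tr_slope_mx|exact: tr_free_mx].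
- move=> u; rewrite sumE => /slope_free_inj[up uq uw].
  have u00 : u 0 0 = 0.
    have [//|u0] := eqVneq (u 0 0) 0; exfalso; apply: phimu; apply/eqP.
      by move/eqP: up; rewrite mulf_eq0 (negbTE u0).
    by move/eqP: uq; rewrite mulf_eq0 oppr_eq0 (negbTE u0).
  apply/rowP => i; rewrite mxE; case: (unliftP 0 i) => [k ->|->//].
  exact: uw.
- move=> u; exists (slope_form (u 0 0) (fun i => u 0 (lift 0 i))).
    by split; [exact: closed_slope_form|exact: typed_slope_form].
  by rewrite sumE mean_slope_form.
- move=> a ca tya; have [z _] := typed_mean ca tya; have [ta _] := ca.
  have [t [m0 m1]] := slope_closed ca tya.
  have skm : (mean_form a)^T = - mean_form a.
    apply/matrixP => i k; rewrite !mxE (entry_skew ta) -scaleN1r.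
    by rewrite (meanZ _ (smooth_entry ta i k)) mulN1r.
  have [w wE] := slope_freeP skm z.
  exists (\row_i if unlift 0 i is Some k then w k else t).
  rewrite sumE {1}wE m0 m1 !mxE unlift_none; congr (_ + _).
  by apply: eq_bigr => i _; rewrite mxE liftK.
Qed.

End Slope.
End Dimensions.

(** * Dimensions along the twist family *)

Section TwistDimension.
Context {R : realType}.
Notation V := 'rV[R]_4.
Notation X := (@torus R 4).

(** The endpoints are negligible; this matters because [sin2] vanishes at 0 and 1, where the slope
    relation gives no control on [a_0j]. *)
Lemma eq_itg_oo (f f' : R -> R) : continuous f -> continuous f' ->
  (forall r, 0 < r < 1 -> f r = f' r) -> itg f = itg f'.
Proof.
move=> cf cf' ff'; rewrite /itg.
have oo h : continuous h ->
    \int[@lebesgue_measure R]_(r in `[0, 1]) h r =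
    \int[@lebesgue_measure R]_(r in `]0, 1[) h r.
  move=> /integrable01 ih.
  rewrite -Rintegral_itv_obnd_cbnd; last first.
    by apply: integrableS ih => //; exact: subset_itv_oc_cc.
  rewrite -Rintegral_itv_bndo_bndc//.
  by apply: integrableS ih => //; exact: subset_itv_oo_cc.
rewrite !oo//; apply: eq_Rintegral => r /set_mem; rewrite /= in_itv/=.
exact: ff'.
Qed.

(** The boolean summand is 0 exactly when [a = 0 < b]. *)
Lemma twist_dim (a b : R) (s : bool) : 0 <= a -> 0 <= b ->
  deRham_dim (H2pm (Kfield (twist a b)) s) (free_dim s + ((0 < a) || (b == 0))).
Proof.
move=> a0 b0; set g := twist a b; have g0 : depends_on_c0 g by exact: eq_twist.
have [ap|] := ltP 0 a; last first.
  move=> aN; have {aN a0} aE : a = 0 by apply/eqP; rewrite eq_le aN.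
  have [bE|bN0] := eqVneq b 0 => /=.
    rewrite addn1; have gE x : g x = 0 by rewrite /g /twist aE bE mul0r addr0.
    have s1 : smooth (cst 1 : V -> R) by exact: smooth_cst.
    apply: (@deRham_dim_slope R g s g0 (cst 1) 0) => //.
    - by move=> x; rewrite gE mulr0.
    - by rewrite mean_cst => /eqP; rewrite oner_eq0.
    - move=> f cf tyf; have [_ m1] := typed_mean g0 cf tyf.
      exists (mean_form f c0 (slope_index s)); rewrite mean_cst mulr1 mulr0.
      by rewrite (m1 0) gE oppr0 mul0r.
  rewrite addn0; apply: deRham_dim_free => // f cf tyf; have [tf _] := cf.
  have [_ m1] := typed_mean g0 cf tyf.
  (* The averaged slope relation is evaluated at [x = 0], where [g] vanishes. *)
  have m10 : mean_form f c1 (slope_index s) = 0.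
    rewrite (m1 0) /g /twist mxE sin2_0 mulr0 addr0 aE oppr0 mul0r//.
  split=> //; rewrite mxE mean_fiber_avg /avg /wavg.
  set B := fiber_avg _; have sB : smooth B.
    by apply: smooth_avgs; exact: smooth_entry.
  rewrite -[RHS](itg_cst 0); apply: eq_itg_oo.
  - apply: (@continuous_wline _ _ (cst 1) B); first by move=> r; exact: cvg_cst.
    exact: smooth_continuous.
  - by move=> r; exact: cvg_cst.
  - move=> r r01; set y := _ + 0; have := m1 y; rewrite m10 => /esym/eqP.
    (* For [0 < r < 1] the point [y] has first coordinate [r], where [sin2] is positive; division by
       [g y] kills the fibre average. *)
    have gy : g y != 0.
      rewrite /g /twist aE add0r mulf_neq0// !mxE !eqxx mulr1 addr0.
      by rewrite gt_eqF// sin2_gt0.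
    rewrite mulf_eq0 oppr_eq0 (negbTE gy)/= => /eqP; rewrite -/B => ->.
    by rewrite mulr0.
rewrite addn1.
have gp x : 0 < g x by rewrite /g /twist ltr_pwDl// mulr_ge0// sin2_ge0.
have gn0 x : g x != 0 by rewrite gt_eqF.
pose phi x := (g x)^-1.
have phi0 : depends_on_c0 phi by move=> x y xy; rewrite /phi (g0 x y xy).
have sphi : smooth phi by apply: smoothV => //; exact: smooth_twist.
apply: (@deRham_dim_slope R g s g0 phi 1) => //.
- by move=> x z; rewrite /phi /g periodic_twist.
- by move=> x; rewrite /phi mulVf.
- by move=> _ /eqP; rewrite oner_eq0.
- move=> f cf tyf; have [tf _] := cf; have [_ m1] := typed_mean g0 cf tyf.
  set k := mean_form f c1 _ in m1 *.
  (* The averaged slope relation reads [k = - g] times the fibre average of [a_0j], so that average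
     is [- k phi]. *)
  exists (- k); rewrite opprK mulr1; split=> //.
  rewrite mxE mean_fiber_avg (mean_indep phi0) (_ : fiber_avg _ = - k *: phi).
    by rewrite avgZ.
  apply/funext => x; rewrite -[RHS]/(- k * (g x)^-1) (m1 x).
  by rewrite -!mulNr opprK mulrAC mulfV// mul1r.
Qed.

(** Every neighbourhood of 0 in the half-line contains some [e / 2 > 0], where [f] is at most
    [c]. *)
Lemma not_lower_semicontinuous_at0 (f : R -> \bar R) (c : R) :
  (c%:E < f 0%R)%E -> (forall t : R, 0 < t -> (f t <= c%:E)%E) ->
  ~ lower_semicontinuous_on `[0, +oo[ f.
Proof.
move=> cf0 fc H; have [U U0 fU] := H 0 c cf0.
have I0 : (`[0, +oo[%classic : set R) 0 by rewrite /= in_itv/= lexx.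
have {}U0 : within `[0, +oo[ (nbhs (0 : R)) U by rewrite (nbhs_subspace_in I0).
have [e /= e0 eU] := (nbhs_ballP _ _).1 U0.
have e20 : 0 < e / 2 by rewrite divr_gt0.
have : U (e / 2).
  apply: eU; last by rewrite /= in_itv/= ltW.
  rewrite /ball/= sub0r normrN gtr0_norm//.
  by rewrite ltr_pdivrMr// ltr_pMr// ltr1n.
by move=> /fU; rewrite ltNge fc.
Qed.

End TwistDimension.

(** * Failure of both semi-continuities at the endpoint of a half-line *)

Theorem proposition4p6 (R : realType) (s : bool) :
  (exists (n : nat) (X : manifold R n.*2) (I : set R) (K : R -> mxfield X)
          (d : R -> nat),
     [/\ compact [set: X], is_interval I, D_complex_curve I K,
         forall t, I t -> deRham_dim (H2pm (K t) s) (d t) &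
         ~ upper_semicontinuous_on I (fun t => ((d t)%:R)%:E)]) /\
  (exists (n : nat) (X : manifold R n.*2) (I : set R) (K : R -> mxfield X)
          (d : R -> nat),
     [/\ compact [set: X], is_interval I, D_complex_curve I K,
         forall t, I t -> deRham_dim (H2pm (K t) s) (d t) &
         ~ lower_semicontinuous_on I (fun t => ((d t)%:R)%:E)]).
Proof.
have itvI : is_interval (`[0, +oo[%classic : set R).
  exact: interval_is_interval.
have sid : smooth (idfun : R -> R).
  by apply: (@smooth_linear R R R idfun) => x; exact: cvg_id.
have scst (c : R) : smooth (cst c : R -> R) by exact: smooth_cst.
(* The threshold [k + 1/2] separates the two dimensions [k] and [k + 1]. *)
have half (k : nat) :
    (k%:R < k%:R + 2^-1 :> R) /\ (k%:R + 2^-1 <= (k + 1)%:R :> R).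
  by rewrite natrD; split; lra.
split; exists 2, (@torus R 4), `[0, +oo[%classic.
  (* The dimension is [free_dim s] at [t = 0] and larger by one for [t > 0]; the jump is tested on
     the negated function. *)
  exists (fun t => Kfield (twist t 1)), (fun t => (free_dim s + (0%R < t)%R)%N).
  split=> //; first exact: compact_torus.
  - exact: (@D_complex_curve_twist R _ idfun (cst 1)).
  - move=> t; rewrite /= in_itv/= andbT => t0.
    by have := twist_dim s t0 (@ler01 R); rewrite oner_eq0 orbF.
  - apply: (@not_lower_semicontinuous_at0 R _ (- ((free_dim s)%:R + 2^-1))).
      by rewrite ltxx addn0 -EFinN lte_fin ltrN2; have [] := half (free_dim s).
    move=> t t0; rewrite t0 -EFinN lee_fin lerN2.
    by have [] := half (free_dim s).
(* Here the dimension is [free_dim s + 1] at [t = 0], where [g = 0], and [free_dim s] for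
   [t > 0]. *)
exists (fun t => Kfield (twist 0 t)), (fun t => (free_dim s + (t == 0%R))%N).
split=> //; first exact: compact_torus.
- exact: (@D_complex_curve_twist R _ (cst 0) idfun).
- move=> t; rewrite /= in_itv/= andbT => t0.
  by have := twist_dim s (lexx (0 : R)) t0; rewrite ltxx.
- apply: (@not_lower_semicontinuous_at0 R _ ((free_dim s)%:R + 2^-1)).
    rewrite eqxx lte_fin; have [_ h] := half (free_dim s).
    by rewrite /= natrD; lra.
  move=> t t0; rewrite gt_eqF// addn0 lee_fin.
  by have [/ltW] := half (free_dim s).
Qed.
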